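(* Let $d\ge1$, $R\ge0$ and $\alpha,\lambda\in[0,\infty)$ with $\alpha<\lambda_b(d)$. Assume that there exists a disagreement coupling family of intensity $\alpha$ and activity $\lambda$, and that there exist $K\ge1$ and $\kappa>0$ such that, for all $A,B\in\mathcal{B}_b$ with $\operatorname{diam}(A)\le1$, $$\mathcal{P}^{\mathrm{poi}}_{\mathbb{R}^d,\alpha}(A\leftrightarrow B\text{ in }\xi)\le K e^{-\kappa\,\delta(A,B)}.$$ Let $\nu$ be the unique Gibbs measure in $\mathcal{G}_\lambda$. Then, with the same constants $K$ and $\kappa$: (a) For all $A,B\in\mathcal{B}_b$ with $\operatorname{diam}(A)\le1$ and $A\subseteq B$, all $C\in\mathcal{C}_{B^c}$, all $x\in(B\cup C)^c$ and all $E\in\mathcal{F}_A$, $$\left|\mathcal{P}^{\mathrm{hs}}_{B,C,\lambda}(\xi_A\in E)-\mathcal{P}^{\mathrm{hs}}_{B,C\cup\{x\},\lambda}(\xi_A\in E)\right|\le K e^{-\kappa\,\delta(A,\{x\})}.$$ (b) For all $A,B\in\mathcal{B}_b$ with $\operatorname{diam}(A)\le1$ and $A\subseteq B$, all $C\in\mathcal{C}_{B^c}$ and all $E\in\mathcal{F}_A$, $$\left|\mathcal{P}^{\mathrm{hs}}_{B,C,\lambda}(\xi_A\in E)-\nu(\xi_A\in E)\right|\le K e^{-\kappa\,\delta(A,B^c)}.$$ (c) For all $A,B\in\mathcal{B}_b$ with $\operatorname{diam}(A)\le1$, all $E\in\mathcal{F}_A$ and all $F\in\mathcal{F}_B$,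 $$\left|\nu(\xi_A\in E,\ \xi_B\in F)-\nu(\xi_A\in E)\,\nu(\xi_B\in F)\right|\le K e^{-\kappa\,\delta(A,B)}.$$
   Context: Space and configurations. Fix $d\ge1$ and a radius $R\in[0,\infty)$. $\|\cdot\|$ is the Euclidean norm and $\mathcal{L}$ Lebesgue measure on $\mathbb{R}^d$. $\mathcal{B}_b$ denotes the bounded Borel sets of $\mathbb{R}^d$ and $B^c$ the complement of $B$ in $\mathbb{R}^d$. $\delta(A,B)=\inf\{\|x-y\|:x\in A,y\in B\}$ and $\operatorname{diam}$ is the Euclidean diameter. For Borel $B$, $\mathcal{C}_B$ is the set of locally finite subsets of $B$ (finite intersection with every bounded set), and $\mathcal{F}_B$ is the $\sigma$-algebra on $\mathcal{C}_B$ generated by the sets $\{C\in\mathcal{C}_B: C\cap A=\emptyset\}$, $A\subseteq B$ Borel (compatible with the Fell topology). A point process law on $B$ is a probability measure on $(\mathcal{C}_B,\mathcal{F}_B)$, with canonical variable $\xi$; write $\xi_A:=\xi\cap A$. On $\mathcal{C}_B^3$ use the product $\sigma$-algebra $\mathcal{F}_B^{\otimes 3}$ with canonical variables $(\xi^1,\xi^2,\xi^3)$. $S_1\triangle S_2$ is the symmetric difference. Connectivity. Points $x,y$ are $R$-connected by a configuration $C$, written $x\leftrightarrow y$ in $C$, if there is a finite path from $x$ to $y$ with jumps of length at most $R$ all of whose intermediate points lie in $C$ (a direct jump without intermediate points is allowed). Two sets are $R$-connected in $C$ (written $A\leftrightarrow B$ in $C$) if some point of one is $R$-connected in $C$ to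 some point of the other. Poisson and Boolean model. $\mathcal{P}^{\mathrm{poi}}_{B,\alpha}$ is the Poisson point process law on $B$ with intensity measure $\alpha\mathcal{L}$. A configuration percolates if it contains an infinite subset that is connected in the graph joining its points at distance at most $R$. The critical intensity is $\lambda_b(d):=\sup\{\alpha\ge0:\ \mathcal{P}^{\mathrm{poi}}_{\mathbb{R}^d,\alpha}(\xi\text{ percolates})=0\}\in(0,\infty]$. Hard-sphere model. For disjoint $Y,C\in\mathcal{C}_{\mathbb{R}^d}$ let $\mathcal{H}(Y|C)\in\{0,1\}$ equal $1$ iff all distinct $x,y\in Y$ satisfy $\|x-y\|>R$ and all $y\in Y$, $x\in C$ satisfy $\|x-y\|>R$. For $B\in\mathcal{B}_b$, $C\in\mathcal{C}_{B^c}$, $\lambda\in[0,\infty)$, the hard-sphere law is $\mathcal{P}^{\mathrm{hs}}_{B,C,\lambda}:=\mathcal{P}^{\mathrm{poi}}_{B,\lambda}(\,\cdot\mid \mathcal{H}(\xi|C)=1)$. Gibbs measures. A van Hove sequence is an increasing sequence $(B_n)_{n\in\mathbb{N}}$ in $\mathcal{B}_b$ converging to $\mathbb{R}^d$ and eventually containing every bounded Borel set. A Gibbs measure of activity $\lambda$ is a weak limit of a sequence $(\mathcal{P}^{\mathrm{hs}}_{B_n,C_n,\lambda})_n$ along a van Hove sequence $(B_n)$ with boundary conditions $C_n\in\mathcal{C}_{B_n^c}$; $\mathcal{G}_\lambda$ is the set of these. Under the existence of a disagreement coupling family of intensity $\alpha<\lambda_b(d)$ at activity $\lambda$, $\mathcal{G}_\lambda$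 is a singleton. Disagreement coupling. For $B\in\mathcal{B}_b$, $C_1,C_2\in\mathcal{C}_{B^c}$, a disagreement coupling of intensity $\alpha$ and activity $\lambda$ is a probability measure $\mathcal{P}$ on $(\mathcal{C}_B^3,\mathcal{F}_B^{\otimes3})$ such that: (i) $\xi^i$ has law $\mathcal{P}^{\mathrm{hs}}_{B,C_i,\lambda}$ for $i=1,2$; (ii) $\xi^3$ has law $\mathcal{P}^{\mathrm{poi}}_{B,\alpha}$; (iii) $\mathcal{P}(\xi^1\triangle\xi^2\subseteq\xi^3)=1$; (iv) $\mathcal{P}(\forall x\in\xi^1\triangle\xi^2:\ x\leftrightarrow C_1\triangle C_2\text{ in }\xi^1\triangle\xi^2)=1$. A disagreement coupling family of intensity $\alpha$ and activity $\lambda$ consists of one disagreement coupling of intensity $\alpha$ and activity $\lambda$ for each $B\in\mathcal{B}_b$ and $C_1,C_2\in\mathcal{C}_{B^c}$. *)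

(* Defs.v *)
From HB Require Import structures.
From mathcomp Require Import all_boot all_order all_algebra.
From mathcomp Require Import all_classical all_reals all_analysis.

Set Implicit Arguments.
Unset Strict Implicit.
Unset Printing Implicit Defensive.
Import Order.TTheory GRing.Theory Num.Theory.
Import numFieldNormedType.Exports.
Local Open Scope classical_set_scope.
Local Open Scope ring_scope.

(** * Euclidean space *)

Section Space.
Context {R : realType} {d : nat}.
Implicit Types (x y : 'rV[R]_d) (A B : set 'rV[R]_d).

(* The library norm on matrices is the sup norm, with the same topology. *)
Definition enorm x : R := Num.sqrt (\sum_(i < d) x ord0 i ^+ 2).

Definition edist x y : R := enorm (x - y).

Definition ebounded A : Prop := exists M : R, forall x, A x -> enorm x <= M.

Definition borel : set (set 'rV[R]_d) := <<s [set U | open U] >>.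

Definition bborel : set (set 'rV[R]_d) := [set A | borel A /\ ebounded A].

(* Extended-real valued, so that the distance to the empty set is +oo. *)
Definition setdist A B : \bar R :=
  ereal_inf [set (edist x y)%:E | x in A & y in B].

Definition diam A : \bar R :=
  ereal_sup [set (edist x y)%:E | x in A & y in A].

End Space.

(* d-dimensional Lebesgue measure of a Borel set, as the iterated integral
   defining the product of d copies of the one-dimensional Lebesgue measure. *)
Fixpoint lebesgue {R : realType} (n : nat) : set 'rV[R]_n -> \bar R :=
  match n with
  | 0%N => fun A => (\1_A (0 : 'rV[R]_0))%:E
  | n'.+1 => fun A =>
      (\int[lebesgue_measure]_(t in [set: R])
         lebesgue [set x : 'rV[R]_n' | A (row_mx (t%:M : 'rV[R]_1) x)])%E
  end.

(** * Configurations *)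

Section Configurations.
Context {R : realType} {d : nat}.
Local Notation V := 'rV[R]_d.
Implicit Types (A B C : set V).

Definition locally_finite C : Prop :=
  forall A, ebounded A -> finite_set (C `&` A).

Definition configs B : set (set V) :=
  [set C | locally_finite C /\ C `<=` B].

Record conf B := Conf { pts : set V ; confP : configs B pts }.

Lemma configs0 B : configs B set0.
Proof. by split=> [A _|//]; rewrite set0I; exact: finite_set0. Qed.

HB.instance Definition _ B := gen_eqMixin (conf B).
HB.instance Definition _ B := gen_choiceMixin (conf B).
HB.instance Definition _ B := isPointed.Build (conf B) (Conf (configs0 B)).

Definition missing B A : set (conf B) := [set xi | pts xi `&` A = set0].

Definition hitting B A : set (conf B) := [set xi | pts xi `&` A !=set0].

Definition conf_gen B : set (set (conf B)) :=
  [set missing A | A in [set A | borel A /\ A `<=` B]].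

Definition conf_display B : measure_display := sigma_display (@conf_gen B).

HB.instance Definition _ B := @isMeasurable.Build (conf_display B) (conf B)
  <<s @conf_gen B >> (@sigma_algebra0 _ setT (@conf_gen B))
  (@sigma_algebraC _ (@conf_gen B)) (@sigma_algebra_bigcup _ setT (@conf_gen B)).

(* The Fell topology: the hitting sets of open sets and the missing sets of
   compact sets form a subbase.  As configurations lie in B, hitting an open G
   is hitting the relatively open G `&` B. *)
Definition fell_subbase B : set (set (conf B)) :=
  [set hitting G | G in [set G | open G]] `|`
  [set missing D | D in [set D | compact D /\ D `<=` B]].

HB.instance Definition _ B := @isSubBaseTopological.Build (conf B)
  (set (conf B)) (@fell_subbase B) id.

Lemma configsI A B (xi : conf B) : configs A (pts xi `&` A).
Proof.
have [lf _] := confP xi; split=> [D bD|x []//].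
by apply: sub_finite_set (lf D bD) => x [[]].
Qed.

Definition restr A B (xi : conf B) : conf A := Conf (configsI A xi).

End Configurations.

(** * Connectivity and the models *)

Section Models.
Context {R : realType} {d : nat}.
Local Notation V := 'rV[R]_d.
Implicit Types (r : R) (A B C Y : set V).

Definition pt_connected r C (x y : V) : Prop :=
  exists2 s : seq V, (forall z, z \in s -> C z)
    & path (fun u v => edist u v <= r) x (rcons s y).

(* For Borel A and B the event that A and B are connected is measurable in
   general only for completed laws (the r-neighbourhood of a Borel set is
   analytic); its probability is to be read as the outer measure P^*, which is
   the value of the completion and agrees with P on measurable events. *)
Definition set_connected r C A B : Prop :=
  exists x y, [/\ A x, B y & pt_connected r C x y].

Definition percolates r C : Prop :=
  exists S, [/\ S `<=` C, infinite_set S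
    & forall x y, S x -> S y -> pt_connected r S x y].

(* Laws are characterized by predicates on set functions, of which only the
   values on measurable sets matter.
   The counts of disjoint bounded Borel sets are independent, with Poisson
   distributions.  The probability mass function is spelled out because the
   library's poisson_pmf is constantly 1 at rate 0. *)
Definition is_poisson B (alpha : R) (mu : set (conf B) -> \bar R) : Prop :=
  forall (k : nat) (A : 'I_k -> set V) (n : 'I_k -> nat),
    (forall i, bborel (A i) /\ A i `<=` B) -> trivIset setT A ->
    mu [set xi | forall i, (pts xi `&` A i #= `I_(n i))%card] =
    (\prod_(i < k)
       let m := alpha * fine (lebesgue (A i)) in
       m ^+ n i / (n i)`!%:R * expR (- m))%:E.

Definition hard_sphere r Y C : Prop :=
  (forall x y, Y x -> Y y -> x <> y -> r < edist x y) /\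
  (forall x y, C x -> Y y -> r < edist x y).

(* The Poisson law on B conditioned on the hard-sphere event, which has positive
   probability for bounded B. *)
Definition is_hs r B C (lambda : R) (mu : set (conf B) -> \bar R) : Prop :=
  exists2 Q : probability (conf B) R, is_poisson lambda Q &
    let H := [set xi : conf B | hard_sphere r (pts xi) C] in
    forall E, measurable E -> mu E = (fine (Q (E `&` H)) / fine (Q H))%:E.

Definition lambda_b r : \bar R :=
  ereal_sup [set alpha%:E | alpha in [set alpha : R | 0 <= alpha /\
    exists2 P : probability (conf [set: V]) R, is_poisson alpha P
      & P [set xi | percolates r (pts xi)] = 0%E]].

Definition van_hove (B : nat -> set V) : Prop :=
  [/\ forall n, bborel (B n),
      forall n, B n `<=` B n.+1,
      \bigcup_n B n = setT
    & forall A, bborel A -> exists N, forall n, (N <= n)%N -> A `<=` B n].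

(* Laws on the configurations of B n are transported to those of the whole
   space by inclusion, which is restr setT. *)
Definition weak_limit (B : nat -> set V)
    (P : forall n, probability (conf (B n)) R)
    (nu : probability (conf [set: V]) R) : Prop :=
  forall f : conf [set: V] -> R, continuous f ->
    (exists M, forall xi, `|f xi| <= M) ->
    (\int[P n]_xi (f (restr setT xi))%:E)%E @[n --> \oo]
      --> (\int[nu]_xi (f xi)%:E)%E.

Definition gibbs r (lambda : R) : set (probability (conf [set: V]) R) :=
  [set nu | exists (B C : nat -> set V)
      (P : forall n, probability (conf (B n)) R),
    [/\ van_hove B,
        forall n, configs (~` B n) (C n),
        forall n, is_hs r (C n) lambda (P n)
      & weak_limit P nu]].

Definition disagreement_coupling r (alpha lambda : R) B (C1 C2 : set V)
    (P : probability (conf B * conf B * conf B)%type R) : Prop :=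
  [/\ is_hs r C1 lambda (pushforward P (fun t => t.1.1)),
      is_hs r C2 lambda (pushforward P (fun t => t.1.2)),
      is_poisson alpha (pushforward P (fun t => t.2)),
      {ae P, forall t, pts t.1.1 `+` pts t.1.2 `<=` pts t.2}
    & {ae P, forall t, forall x, (pts t.1.1 `+` pts t.1.2) x ->
        set_connected r (pts t.1.1 `+` pts t.1.2) [set x] (C1 `+` C2)}].

Definition disagreement_family r (alpha lambda : R)
    (P : forall B, set V -> set V ->
       probability (conf B * conf B * conf B)%type R) : Prop :=
  forall B C1 C2, bborel B -> configs (~` B) C1 -> configs (~` B) C2 ->
    disagreement_coupling r alpha lambda C1 C2 (P B C1 C2).

End Models.

Arguments lambda_b {R} d r.
Arguments gibbs {R} d r lambda.
Arguments restr {R d} A {B} xi.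

(* Main.v *)
(* Two hard-sphere laws on [W] with boundary conditions [C1] and [C2], coupled by
   disagreement, agree on [A] unless [A] is connected to [C1 `+` C2] in the
   dominating Poisson configuration, and the decay hypothesis bounds the
   probability of that connection; this is (a).  Conditioning a hard-sphere law on
   part of its configuration gives hard-sphere laws with other boundary conditions,
   so averaging the coupling bound yields finite-volume versions of (b) and (c).
   The same bound shows that the finite-volume approximations of a Gibbs measure
   are Cauchy in total variation on every bounded set, which upgrades weak
   convergence in the Fell topology to convergence of the probability of every
   local event, and (b) and (c) pass to the limit. *)

From HB Require Import structures.
Require Import Defs.
From mathcomp Require Import all_boot all_order all_algebra.
From mathcomp Require Import all_classical all_reals all_analysis.
From mathcomp Require Import measurable_realfun ring lra.

Set Implicit Arguments.
Unset Strict Implicit.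
Unset Printing Implicit Defensive.
Import Order.TTheory GRing.Theory Num.Theory.
Import numFieldNormedType.Exports.
Local Open Scope classical_set_scope.
Local Open Scope ring_scope.

(* [all_analysis] shadows [Defs.edist]. *)
Local Notation edist := Defs.edist.

(** * Euclidean geometry and Borel sets *)

(** The final bounds keep [K] and [kappa] because they never add two errors. A coupling bounds each
    one-sided difference of two events by the same connection probability, and averaging conditional
    laws preserves any bound that is uniform in the boundary condition. In (c), all conditional
    probabilities of [E] given the configuration in [B] lie within the bound of one another, hence
    of their average. The decay hypothesis fits its uses badly in two ways. It needs a bounded
    target, while the complement of a volume is unbounded; but a path leaving the volume lands
    within [r] of it. It needs diameter at most 1, while the Cauchy property concerns all bounded
    sets; a finite cover costs a factor that only delays convergence. In the limit, the obstacle is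
    that indicators of hitting events are not Fell-continuous. Regularity makes the approximation
    error small for one fixed law at a time; the Cauchy property carries it from one [P N] to all
    later laws. *)

Section EuclideanSpace.
Context {R : realType} {d : nat}.
Local Notation V := 'rV[R]_d.
Implicit Types (x y z : V) (A B U : set V).

Lemma enorm_ge0 x : 0 <= enorm x.
Proof. exact: sqrtr_ge0. Qed.

Lemma enorm_sqr x : enorm x ^+ 2 = \sum_(i < d) x ord0 i ^+ 2.
Proof. by rewrite sqr_sqrtr// sumr_ge0// => i _; exact: sqr_ge0. Qed.

Lemma enormN x : enorm (- x) = enorm x.
Proof.
by rewrite /enorm; congr Num.sqrt; apply: eq_bigr => i _; rewrite mxE sqrrN.
Qed.

Lemma enorm0 : enorm (0 : V) = 0.
Proof.
by rewrite /enorm big1 ?sqrtr0// => i _; rewrite mxE expr0n.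
Qed.

Lemma coord_le_enorm x i : `|x ord0 i| <= enorm x.
Proof.
rewrite -(@ler_pXn2r _ 2)// ?nnegrE ?enorm_ge0// enorm_sqr real_normK ?num_real//.
by rewrite (bigD1 i)//= lerDl sumr_ge0// => j _; exact: sqr_ge0.
Qed.

(** The crude factor [d] instead of its square root is enough: the bound only serves to compare
    topologies and to approximate points by rational ones. *)
Lemma enorm_le_coord x (e : R) : 0 <= e ->
  (forall i, `|x ord0 i| <= e) -> enorm x <= d%:R * e.
Proof.
move=> e0 xe; have de0 : 0 <= d%:R * e by rewrite mulr_ge0.
rewrite -(@ler_pXn2r _ 2)// ?nnegrE ?enorm_ge0// enorm_sqr.
apply: (@le_trans _ _ (\sum_(i < d) e ^+ 2)).
  apply: ler_sum => i _; rewrite -real_normK ?num_real//.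
  by rewrite ler_pXn2r// nnegrE.
rewrite sumr_const card_ord -[leLHS]mulr_natl exprMn ler_wpM2r ?sqr_ge0//.
by rewrite -natrX ler_nat; case: d => // n; rewrite expnS expn1 leq_pmulr.
Qed.

(** Cauchy-Schwarz: for nonzero vectors, the sum of squares of the entries of
    [enorm y *: x - enorm x *: y] is a positive multiple of the difference of the two sides. *)
Lemma dot_le_enorm x y :
  \sum_(i < d) x ord0 i * y ord0 i <= enorm x * enorm y.
Proof.
have [x0|x0] := eqVneq (enorm x) 0.
  rewrite x0 mul0r big1// => i _.
  by have := coord_le_enorm x i; rewrite x0 normr_le0 => /eqP ->; rewrite mul0r.
have [y0|y0] := eqVneq (enorm y) 0.
  rewrite y0 mulr0 big1// => i _.
  by have := coord_le_enorm y i; rewrite y0 normr_le0 => /eqP ->; rewrite mulr0.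
have xy_gt0 : 0 < enorm x * enorm y.
  by rewrite mulr_gt0// lt_def enorm_ge0 ?x0 ?y0.
have : 0 <= \sum_(i < d) (x ord0 i * enorm y - y ord0 i * enorm x) ^+ 2.
  by apply: sumr_ge0 => i _; exact: sqr_ge0.
have -> : \sum_(i < d) (x ord0 i * enorm y - y ord0 i * enorm x) ^+ 2 =
  2 * (enorm x * enorm y) *
  (enorm x * enorm y - \sum_(i < d) x ord0 i * y ord0 i).
  transitivity (enorm y ^+ 2 * (\sum_(i < d) x ord0 i ^+ 2) +
    enorm x ^+ 2 * (\sum_(i < d) y ord0 i ^+ 2) -
    2 * (enorm x * enorm y) * (\sum_(i < d) x ord0 i * y ord0 i)).
    rewrite !mulr_sumr -sumrN -!big_split/=; apply: eq_bigr => i _; ring.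
  rewrite -!enorm_sqr; ring.
by rewrite pmulr_rge0 ?subr_ge0// mulr_gt0.
Qed.

Lemma enormD x y : enorm (x + y) <= enorm x + enorm y.
Proof.
rewrite -(@ler_pXn2r _ 2)// ?nnegrE ?addr_ge0 ?enorm_ge0// sqrrD !enorm_sqr.
have -> : \sum_(i < d) (x + y) ord0 i ^+ 2 = \sum_(i < d) x ord0 i ^+ 2 +
    (\sum_(i < d) x ord0 i * y ord0 i) *+ 2 + \sum_(i < d) y ord0 i ^+ 2.
  rewrite -sumrMnl -!big_split/=; apply: eq_bigr => i _.
  by rewrite !mxE sqrrD.
by rewrite lerD2r lerD2l lerMn2r/= dot_le_enorm.
Qed.

Lemma edist_ge0 x y : 0 <= edist x y.
Proof. exact: enorm_ge0. Qed.

Lemma edistC x y : edist x y = edist y x.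
Proof. by rewrite /edist -enormN opprB. Qed.

Lemma edistxx x : edist x x = 0.
Proof. by rewrite /edist subrr enorm0. Qed.

Lemma edist_triangle y x z : edist x z <= edist x y + edist y z.
Proof.
by rewrite /edist -[x - z](_ : (x - y) + (y - z) = _) ?enormD// addrA subrK.
Qed.

Lemma edist_eq0 x y : edist x y = 0 -> x = y.
Proof.
move=> xy0; apply/eqP; rewrite -subr_eq0; apply/eqP/rowP => i; rewrite [RHS]mxE.
by have := coord_le_enorm (x - y) i; rewrite -/(edist x y) xy0 normr_le0 => /eqP.
Qed.

Lemma edist_gt0 x y : x <> y -> 0 < edist x y.
Proof.
move=> xy; rewrite lt_def edist_ge0 andbT; apply/eqP => /edist_eq0.
exact: xy.
Qed.

Lemma enorm_le_edist x y : enorm y <= enorm x + edist x y.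
Proof. by rewrite edistC -[y in leLHS](subrK x) addrC enormD. Qed.

Lemma ball_edist x (e : R) : 0 < e ->
  exists2 e', 0 < e' & ball x e' `<=` [set y | edist x y < e].
Proof.
(* Dividing by [d.+1] keeps the final inequality strict and covers [d = 0]. *)
move=> e0; exists (e / d.+1%:R); first by rewrite divr_gt0.
move=> y [_ xy] /=; apply: (@le_lt_trans _ _ (d%:R * (e / d.+1%:R))).
  apply: enorm_le_coord => [|i]; first by rewrite divr_ge0// ltW.
  by have := xy ord0 i; rewrite /ball/= !mxE => /ltW.
by rewrite mulrCA gtr_pMr// ltr_pdivrMr// mul1r ltr_nat.
Qed.

Lemma edist_ball x (e : R) : 0 < e -> [set y | edist x y < e] `<=` ball x e.
Proof.
move=> e0 y /= xy; split=> // i j; rewrite (ord1 i) /ball/=.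
by apply: le_lt_trans xy; have := coord_le_enorm (x - y) j; rewrite !mxE.
Qed.

(** The library topology comes from the sup norm; this allows openness to be tested on Euclidean
    balls. *)
Lemma open_edistP U :
  open U <-> forall x, U x -> exists2 e, 0 < e & [set y | edist x y < e] `<=` U.
Proof.
split=> [oU x Ux|hU].
  have := open_nbhs_nbhs (conj oU Ux); rewrite -nbhs_ballE => -[e /= e0 xeU].
  by exists e => //; exact: subset_trans (edist_ball e0) xeU.
rewrite openE => x /hU[e e0 xeU]; rewrite /interior -nbhs_ballE.
by have [e' e'0 h] := ball_edist x e0; exists e' => //; exact: subset_trans h xeU.
Qed.

Lemma open_eball x (e : R) : open [set y | edist x y < e].
Proof.
apply/open_edistP => y /= xy; exists (e - edist x y); rewrite ?subr_gt0//.
by move=> z /=; rewrite ltrBrDl; apply: le_lt_trans; exact: edist_triangle.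
Qed.

Lemma closed_eball x (e : R) : closed [set y | edist x y <= e].
Proof.
rewrite -openC; apply/open_edistP => y /= /negP; rewrite -ltNge => xy.
exists (edist x y - e); rewrite ?subr_gt0// => z /= yz; apply/negP.
rewrite -ltNge; have := edist_triangle z x y; rewrite (edistC z y); lra.
Qed.

Lemma ebounded_closed_compact A : ebounded A -> closed A -> compact A.
Proof.
move=> [M AM]; apply: bounded_closed_compact; exists (`|M|); split=> //.
move=> N MN x Ax; rewrite /= [leLHS]mx_normrE; apply/bigmax_leP; split.
  by rewrite ltW// (le_lt_trans _ MN).
move=> [i j] _ /=; rewrite (ord1 i); apply: le_trans (coord_le_enorm _ _) _.
by rewrite (le_trans (AM _ Ax))// (le_trans (ler_norm _))// ltW.
Qed.

Definition eball0 (M : R) : set V := [set x | enorm x < M].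

Lemma eball0E M : eball0 M = [set y | edist 0 y < M].
Proof. by apply/seteqP; split=> y; rewrite /eball0 /= /edist sub0r enormN. Qed.

Lemma open_eball0 M : open (eball0 M).
Proof. by rewrite eball0E; exact: open_eball. Qed.

Lemma ebounded_eball0 M : ebounded (eball0 M).
Proof. by exists M => x /ltW. Qed.

Lemma ebounded_sub A B : A `<=` B -> ebounded B -> ebounded A.
Proof. by move=> AB [M BM]; exists M => x /AB/BM. Qed.

Lemma ebounded_eball0P A : ebounded A -> exists2 M, 0 < M & A `<=` eball0 M.
Proof.
move=> [M AM]; exists (`|M| + 1); first by rewrite ltr_wpDl.
move=> x /AM xM; rewrite /eball0/=; have := ler_norm M; lra.
Qed.

Lemma eboundedU A B : ebounded A -> ebounded B -> ebounded (A `|` B).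
Proof.
move=> [M AM] [N BN]; exists (Num.max M N) => x [/AM|/BN] xM.
  by rewrite le_max xM.
by rewrite le_max xM orbT.
Qed.

Lemma borel_open U : open U -> borel U.
Proof. by move=> oU; exact: sub_sigma_algebra. Qed.

Lemma borel0 : borel (set0 : set V).
Proof. exact: sigma_algebra0. Qed.

Lemma borelC A : borel A -> borel (~` A).
Proof. by move=> bA; rewrite -setTD; exact: sigma_algebraCD. Qed.

Lemma borelT : borel [set: V].
Proof. by rewrite -setC0; apply: borelC; exact: borel0. Qed.

Lemma borel_closed A : closed A -> borel A.
Proof. by rewrite -openC => /borel_open/borelC; rewrite setCK. Qed.

Lemma borel_bigcup (F : nat -> set V) :
  (forall i, borel (F i)) -> borel (\bigcup_i F i).
Proof. exact: (@sigma_algebra_bigcup _ setT [set U : set V | open U] F). Qed.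

Lemma borelU A B : borel A -> borel B -> borel (A `|` B).
Proof.
move=> bA bB; rewrite -bigcup2E; apply: borel_bigcup => -[|[|n]]//=.
exact: borel0.
Qed.

Lemma borelI A B : borel A -> borel B -> borel (A `&` B).
Proof.
move=> /borelC bA /borelC bB; rewrite -[_ `&` _]setCK setCI.
by apply: borelC; exact: borelU.
Qed.

Lemma borelD A B : borel A -> borel B -> borel (A `\` B).
Proof. by move=> bA /borelC; exact: borelI. Qed.

Lemma borel_eball0 M : borel (eball0 M).
Proof. apply: borel_open; exact: open_eball0. Qed.

Lemma bborelU A B : bborel A -> bborel B -> bborel (A `|` B).
Proof. by move=> [? ?] [? ?]; split; [exact: borelU|exact: eboundedU]. Qed.

Lemma bborelIl A B : bborel A -> borel B -> bborel (A `&` B).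
Proof.
move=> [? bA] ?; split; first exact: borelI.
exact: ebounded_sub (@subIsetl _ _ _) bA.
Qed.

Lemma bborelD A B : bborel A -> borel B -> bborel (A `\` B).
Proof. by move=> bA /borelC; exact: bborelIl. Qed.

Lemma bborel_eball0 M : bborel (eball0 M).
Proof. by split; [exact: borel_eball0|exact: ebounded_eball0]. Qed.

Lemma ebounded_cover (A : set V) (e : R) : 0 < e -> ebounded A ->
  exists s : seq V, A `<=` \bigcup_(x in [set` s]) [set y | edist x y < e].
Proof.
move=> e0 /ebounded_eball0P[M M0 AM].
have cK : compact [set x : V | edist 0 x <= M].
  apply: ebounded_closed_compact; last exact: closed_eball.
  by exists M => x; rewrite /= /edist sub0r enormN.
rewrite compact_cover in cK.
have [|x /= _|s _ Ks] := cK V [set: V] (fun x => [set y | edist x y < e]).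
- by move=> x _; exact: open_eball.
- by exists x => //=; rewrite edistxx.
exists (finmap.enum_fset s) => x /AM; rewrite eball0E /= => /ltW xM.
by have [y ys xy] := Ks x xM; exists y.
Qed.

End EuclideanSpace.

(** * Laws of configurations *)

Lemma measure_setC1 d (T : measurableType d) (R : realType)
    (m : {measure set T -> \bar R}) A :
  m setT = 1%E -> measurable A -> m (~` A) = (1 - m A)%E.
Proof.
move=> m1 mA; have fmA : m A \is a fin_num.
  by rewrite ge0_fin_numE// (@le_lt_trans _ _ 1%E) ?ltry// -m1 le_measure ?inE.
apply/esym/eqP; rewrite sube_eq ?fin_num_adde_defl//.
by rewrite -m1 -measureU ?setICl ?setvU//; exact: measurableC.
Qed.

Lemma exists_image_law d d' (T : measurableType d) (T' : measurableType d')
    (R : realType) (P : probability T R) (f : T -> T') :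
  measurable_fun setT f ->
  exists P' : probability T' R, (forall S, P' S = P (f @^-1` S)) /\
    forall g : T' -> \bar R, measurable_fun setT g -> (forall y, 0 <= g y)%E ->
      (\int[P']_y g y = \int[P]_x g (f x))%E.
Proof.
move=> mf; pose f' : {mfun T >-> T'} := HB.pack f (isMeasurableFun.Build _ _ _ _ _ mf).
exists (distribution P f'); split=> // g mg g0.
exact: (@ge0_integral_distribution _ _ _ _ _ P f' g mg g0).
Qed.

Section ConfigurationMeasurability.
Context {R : realType} {d : nat}.
Local Notation V := 'rV[R]_d.
Implicit Types (A B C L W : set V).

Lemma conf_eq B (xi eta : conf B) : pts xi = pts eta -> xi = eta.
Proof.
case: xi eta => [x hx] [y hy] /= xy; move: hy; rewrite -xy => hy.
by congr Conf; exact: Prop_irrelevance.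
Qed.

Lemma missing_hitting B A : (missing A : set (conf B)) = ~` hitting A.
Proof.
apply/seteqP; split=> xi; rewrite /missing /hitting/=.
  by move=> -> [x []].
by move=> /set0P/negP; rewrite negbK => /eqP.
Qed.

Lemma hitting_missing B A : (hitting A : set (conf B)) = ~` missing A.
Proof. by rewrite missing_hitting setCK. Qed.

Lemma hittingS B A A' : A `<=` A' -> (hitting A : set (conf B)) `<=` hitting A'.
Proof. by move=> AA' xi [x [? /AA' ?]]; exists x. Qed.

Lemma missingU B A A' :
  (missing (A `|` A') : set (conf B)) = missing A `&` missing A'.
Proof.
apply/seteqP; split=> xi; rewrite /missing/= setIUr;
  by rewrite setU_eq0.
Qed.

Lemma hitting_bigcup B I (D : set I) (F : I -> set V) :
  (hitting (\bigcup_(i in D) F i) : set (conf B)) = \bigcup_(i in D) hitting (F i).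
Proof.
apply/seteqP; split=> xi; first by move=> [x [? [i Di Fx]]]; exists i => //; exists x.
by move=> [i Di [x [? ?]]]; exists x; split=> //; exists i.
Qed.

Lemma missing_bigcup B I (D : set I) (F : I -> set V) :
  (missing (\bigcup_(i in D) F i) : set (conf B)) = \bigcap_(i in D) missing (F i).
Proof.
rewrite missing_hitting hitting_bigcup setC_bigcup.
by apply: eq_bigcapr => i _; rewrite missing_hitting.
Qed.

(** Removes the constraint [A]<=[B] in the generators, so that missing any Borel set is
    measurable. *)
Lemma missing_setIr B A : (missing (A `&` B) : set (conf B)) = missing A.
Proof.
have E (xi : conf B) : pts xi `&` (A `&` B) = pts xi `&` A.
  by have [_ sB] := confP xi; rewrite setIA; apply/setIidPl => x [/sB].
by apply/seteqP; split=> xi; rewrite /missing/= E.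
Qed.

Lemma measurable_missing B A : borel B -> borel A ->
  measurable (missing A : set (conf B)).
Proof.
move=> bB bA; rewrite -missing_setIr; apply: sub_sigma_algebra.
by exists (A `&` B) => //; split; [exact: borelI|exact: subIsetr].
Qed.

Lemma measurable_hitting B A : borel B -> borel A ->
  measurable (hitting A : set (conf B)).
Proof.
by move=> bB bA; rewrite hitting_missing; apply: measurableC; exact: measurable_missing.
Qed.

Lemma measurable_conf_fun d' (T : measurableType d') B (f : T -> conf B) :
  (forall A, borel A -> A `<=` B -> measurable (f @^-1` missing A)) ->
  measurable_fun setT f.
Proof.
move=> h; apply: (@measurability _ _ T (conf B) setT f (@conf_gen R d B)) => //.
move=> _ [_ [A [bA AB] <-]] <-; rewrite setTI; exact: h.
Qed.

Lemma measurable_restr A B : borel A -> borel B ->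
  measurable_fun setT (restr A : conf B -> conf A).
Proof.
move=> bA bB; apply: measurable_conf_fun => D bD DA.
rewrite (_ : _ @^-1` _ = missing D); first exact: measurable_missing.
have {2}<- : A `&` D = D by exact/setIidPr.
apply/seteqP; split=> xi; rewrite /missing /preimage/=;
  by rewrite setIA.
Qed.

Lemma measurable_restr_preimage A B (E : set (conf A)) : borel A -> borel B ->
  measurable E -> measurable ((restr A : conf B -> conf A) @^-1` E).
Proof.
by move=> bA bB mE; rewrite -[X in measurable X]setTI; exact: measurable_restr.
Qed.

Lemma restr_restr A W B (xi : conf B) : A `<=` W ->
  restr A (restr W xi) = restr A xi.
Proof.
by move=> AW; apply: conf_eq; rewrite /= -setIA; congr (_ `&` _); exact/setIidPr.
Qed.

Lemma locally_finiteU C C' :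
  locally_finite C -> locally_finite C' -> locally_finite (C `|` C').
Proof.
by move=> hC hC' D bD; rewrite setIUl finite_setU; split; [exact: hC|exact: hC'].
Qed.

Lemma configs_glue L W W' (xi : conf W) (eta : conf W') :
  configs L ((pts xi `|` pts eta) `&` L).
Proof.
split=> [D bD|x []//]; have [lf _] := confP xi; have [lf' _] := confP eta.
by apply: sub_finite_set (locally_finiteU lf lf' bD) => x [[]].
Qed.

(** Cutting with [L] makes the union a configuration in [L] without side conditions; nothing is lost
    when [W] and [W'] partition [L]. *)
Definition glue L W W' (t : conf W * conf W') : conf L :=
  Conf (@configs_glue L W W' t.1 t.2).

Lemma measurable_glue L W W' : borel L -> borel W -> borel W' ->
  measurable_fun setT (@glue L W W').
Proof.
move=> bL bW bW'; apply: measurable_conf_fun => D bD DL.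
rewrite (_ : _ @^-1` _ = missing D `*` missing D).
  by apply: measurableX; exact: measurable_missing.
have E (t : conf W * conf W') :
    (pts t.1 `|` pts t.2) `&` L `&` D =
    (pts t.1 `&` D) `|` (pts t.2 `&` D).
  by rewrite -setIA (_ : L `&` D = D) ?setIUl//; exact/setIidPr.
apply/seteqP; split=> t; rewrite /missing/= E;
  by rewrite setU_eq0.
Qed.

Arguments glue L {W W'} t.

Lemma measurable_glue_section L W W' (eta : conf W) (S : set (conf L)) :
  borel L -> borel W -> borel W' -> measurable S ->
  measurable [set xi : conf W' | S (glue L (eta, xi))].
Proof.
move=> bL bW bW' mS; rewrite -[X in measurable X]setTI.
have := measurableT_comp (measurable_glue bL bW bW') (pair1_measurable eta).
exact.
Qed.

Lemma eball0_exhaust : \bigcup_n eball0 n%:R = [set: V].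
Proof.
apply/seteqP; split=> // x _; exists (Num.truncn (enorm x)).+1 => //.
by rewrite /eball0 /= truncnS_gt.
Qed.

Definition bmissing B : set (set (conf B)) :=
  [set missing A | A in [set A | bborel A /\ A `<=` B]].

(** Poisson laws are only specified on bounded sets. Missing [A] means missing its part in each ball
    [eball0 n%:R], so bounded sets already generate. *)
Lemma measurable_bmissing B : @measurable _ (conf B) = <<s @bmissing B >>.
Proof.
apply/seteqP; split; last first.
  apply: sub_sigma_algebra2 => _ [A [[bA _] AB] <-]; exists A => //.
apply: smallest_sub; first exact: smallest_sigma_algebra.
move=> _ [A [bA AB] <-]; rewrite -[A]setIT -eball0_exhaust setI_bigcupr.
rewrite missing_bigcup -[X in <<s _ >> X]setCK setC_bigcap.
apply: sigma_algebraC; apply: sigma_algebra_bigcup => n; apply: sigma_algebraC.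
apply: sub_sigma_algebra; exists (A `&` eball0 n%:R) => //; split.
  by rewrite setIC; apply: bborelIl => //; exact: bborel_eball0.
by move=> x [/AB].
Qed.

Lemma setI_closed_bmissing B : setI_closed (@bmissing B).
Proof.
move=> _ _ [A [bA AB] <-] [A' [bA' AB'] <-]; exists (A `|` A'); last exact: missingU.
by split; [exact: bborelU|rewrite subUset].
Qed.

(** Void probabilities determine a law (Rényi): the missing events form a pi-system, since missing
    two sets is missing their union, and they generate the sigma-algebra. *)
Lemma conf_law_unique B (P P' : {measure set (conf B) -> \bar R}) :
  P setT = 1%E -> P' setT = 1%E ->
  (forall A, bborel A -> A `<=` B -> P (missing A) = P' (missing A)) ->
  forall S, measurable S -> P S = P' S.
Proof.
move=> P1 P'1 h S; rewrite measurable_bmissing.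
move: S; apply: (dynkin_induction (@measurable_bmissing B)
  (@setI_closed_bmissing B)).
- by rewrite P1 P'1.
- by move=> _ [A [bA AB] <-]; exact: h.
- move=> A mA PA.
  by rewrite (measure_setC1 P1 mA) (measure_setC1 P'1 mA) PA.
- move=> F mF tF PF; rewrite !measure_semi_bigcup//; last 2 first.
  + exact: bigcup_measurable.
  + exact: bigcup_measurable.
  by apply: eq_eseriesr => n _; exact: PF.
Qed.

End ConfigurationMeasurability.
Arguments glue {R d} L {W W'} t.

Lemma exists_image_measure d d' (T : measurableType d) (T' : measurableType d')
    (R : realType) (m : {measure set T -> \bar R}) (f : T -> T') :
  measurable_fun setT f ->
  exists m' : {measure set T' -> \bar R}, forall S, m' S = m (f @^-1` S).
Proof.
move=> mf.
by exists (measure_function_pushforward__canonical__measure_function_Measure m mf).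
Qed.

(** * Poisson laws: void probabilities and independence *)

Section PoissonLaws.
Context {R : realType} {d : nat}.
Local Notation V := 'rV[R]_d.
Implicit Types (A B C L W : set V).

Definition void_prob (lam : R) A : R := expR (- (lam * fine (Defs.lebesgue A))).

Lemma poisson_void lam B (Q : set (conf B) -> \bar R) A :
  is_poisson lam Q -> bborel A -> A `<=` B -> Q (missing A) = (void_prob lam A)%:E.
Proof.
move=> hQ bA AB; have := hQ 1%N (fun=> A) (fun=> 0%N).
rewrite big_ord1 /= expr0 fact0 divr1 mul1r => <-//.
- congr Q; apply/seteqP; split=> xi; rewrite /missing /= II0 => h.
    by move=> _; rewrite h.
  by have := h ord0; rewrite card_eq0 => /eqP.
- by apply/trivIsetP => i j _ _; rewrite (ord1 i) (ord1 j) eqxx.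
Qed.

Lemma poisson_void_indep lam B (Q : set (conf B) -> \bar R) A A' :
  is_poisson lam Q -> bborel A -> A `<=` B -> bborel A' -> A' `<=` B ->
  A `&` A' = set0 ->
  (Q (missing A `&` missing A') = Q (missing A) * Q (missing A'))%E.
Proof.
move=> hQ bA AB bA' A'B AA'; rewrite !(poisson_void hQ)//.
have := hQ 2%N (fun i => if i == ord0 then A else A') (fun=> 0%N).
rewrite -EFinM /void_prob big_ord_recl big_ord1 /= !expr0 !fact0 divr1 !mul1r => <-//.
- congr Q; apply/seteqP; split=> xi; rewrite /missing /= II0.
    by move=> [h h'] i; case: ifP => _; rewrite ?h ?h'.
  move=> h; have := h ord0; have := h ord_max; rewrite /= !card_eq0.
  by move=> /eqP -> /eqP ->.
- by move=> i; case: ifP.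
- apply/trivIsetP => i j _ _ ij; case: (i =P ord0) => i0; case: (j =P ord0) => j0 //.
  + by rewrite i0 j0 eqxx in ij.
  + by rewrite setIC.
  + move: i0 j0 ij; case: (unliftP ord0 i) => [k ->|->//] _.
    case: (unliftP ord0 j) => [l ->|->//] _.
    by rewrite (ord1 k) (ord1 l) eqxx.
Qed.

(** By [conf_law_unique] only void probabilities need to factorize, and those do by independence on
    disjoint sets. *)
Lemma poisson_product lam L W1 W2 (Q : probability (conf L) R)
    (Q1 : probability (conf W1) R) (Q2 : probability (conf W2) R) :
  borel W1 -> borel W2 -> W1 `&` W2 = set0 -> W1 `|` W2 = L -> is_poisson lam Q ->
  (forall S, Q1 S = Q (restr W1 @^-1` S)) ->
  (forall S, Q2 S = Q (restr W2 @^-1` S)) ->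
  forall S, measurable S -> Q S = (Q1 \x Q2)%E (glue L @^-1` S).
Proof.
move=> bW1 bW2 W120 W12L hQ Q1E Q2E.
have bL : borel L by rewrite -W12L; exact: borelU.
have [m mE] := exists_image_measure (Q1 \x Q2)%E (measurable_glue bL bW1 bW2).
move=> S mS; rewrite -mE; move: S mS; apply: conf_law_unique.
- exact: probability_setT.
- rewrite mE preimage_setT.
  have := product_measure1E Q1 Q2 measurableT measurableT.
  rewrite setXTT => QQ; apply: (etrans QQ); rewrite -[RHS]mule1.
  by congr (_ * _)%E; exact: probability_setT.
- move=> A bA AL; rewrite mE.
  have -> : glue L @^-1` (missing A) =
      (missing A : set (conf W1)) `*` (missing A : set (conf W2)).
    have E (t : conf W1 * conf W2) :
        (pts t.1 `|` pts t.2) `&` L `&` A = (pts t.1 `&` A) `|` (pts t.2 `&` A).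
      by rewrite -setIA (_ : L `&` A = A) ?setIUl//; exact/setIidPr.
    by apply/seteqP; split=> t; rewrite /missing/= E setU_eq0.
  symmetry; apply: etrans.
    apply: (product_measure1E Q1 Q2 (A1 := missing A) (A2 := missing A)).
      exact: measurable_missing bW1 bA.1.
    exact: measurable_missing bW2 bA.1.
  have E D : restr D @^-1` missing A = (missing (A `&` D) : set (conf L)).
    by apply/seteqP; split=> xi; rewrite /missing/= setIAC setIA.
  transitivity (Q (restr W1 @^-1` missing A) *
      Q (restr W2 @^-1` missing A))%E; first by rewrite -Q1E -Q2E.
  rewrite !E -(poisson_void_indep hQ).
  + by rewrite -missingU -setIUr W12L (setIidl AL).
  + exact: bborelIl.
  + by move=> x [/AL].
  + exact: bborelIl.
  + by move=> x [/AL].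
  + by rewrite setIACA W120 setI0.
Qed.

Lemma poisson_fubini lam L W1 W2 (Q : probability (conf L) R)
    (Q1 : probability (conf W1) R) (Q2 : probability (conf W2) R) :
  borel W1 -> borel W2 -> W1 `&` W2 = set0 -> W1 `|` W2 = L -> is_poisson lam Q ->
  (forall S, Q1 S = Q (restr W1 @^-1` S)) ->
  (forall S, Q2 S = Q (restr W2 @^-1` S)) ->
  forall S, measurable S ->
  measurable_fun [set: conf W1] (fun eta => Q2 [set xi | S (glue L (eta, xi))]) /\
  Q S = (\int[Q1]_eta Q2 [set xi | S (glue L (eta, xi))])%E.
Proof.
move=> bW1 bW2 W120 W12L hQ Q1E Q2E S mS.
have bL : borel L by rewrite -W12L; exact: borelU.
have mg : measurable ((glue L : conf W1 * conf W2 -> _) @^-1` S).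
  by rewrite -[X in measurable X]setTI; exact: measurable_glue.
have E : (fun eta => Q2 [set xi | S (glue L (eta, xi))]) =
    Q2 \o xsection ((glue L : conf W1 * conf W2 -> _) @^-1` S).
  apply/funext => eta /=; congr (Q2 _); apply/seteqP; split=> xi.
    by move=> h; apply/mem_set.
  by rewrite /xsection /= inE.
split; first by rewrite E; exact: measurable_fun_xsection.
by rewrite (poisson_product bW1 bW2 W120 W12L hQ Q1E Q2E mS) E.
Qed.

End PoissonLaws.

Lemma finite_gap (R : realType) (T : choiceType) (S : set T) (f : T -> R) (a : R) :
  finite_set S -> (forall t, S t -> a < f t) ->
  exists2 e, 0 < e & forall t, S t -> a + e <= f t.
Proof.
move=> /finite_seqP[s ->]; elim: s => [|t s IH] h; first by exists 1.
have [|e e0 he] := IH; first by move=> u /= us; apply: h; rewrite /= inE us orbT.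
exists (Num.min e (f t - a)).
  by rewrite lt_min e0 subr_gt0 h//= inE eqxx.
move=> u /=; rewrite inE => /predU1P[->|us].
  by rewrite -lerBrDl ge_min lexx orbT.
by apply: le_trans (he _ us); rewrite lerD2l ge_min lexx.
Qed.

(** * Measurability and chain rule of the hard-sphere event *)

Section HardSphereEvent.
Context {R : realType} {d : nat}.
Local Notation V := 'rV[R]_d.
Implicit Types (A B C L W : set V) (x y : V).

Definition ratball (i : 'rV[rat]_d * nat) : set V :=
  [set y | edist (map_mx ratr i.1) y < i.2.+1%:R^-1].

Lemma ratball_base x (e : R) : 0 < e ->
  exists i, ratball i x /\ ratball i `<=` [set y | edist x y < e].
Proof.
move=> e0; pose k := Num.truncn (2 / e); pose h : R := k.+1%:R^-1.
have h0 : 0 < h by rewrite invr_gt0.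
have he : h + h < e.
  suff : h < e / 2 by lra.
  by rewrite /h -[ltRHS]invf_div ltf_pV2 ?posrE ?divr_gt0// /k truncnS_gt.
have /fin_all_exists[q hq] (j : 'I_d) :
    exists q : rat, `|ratr q - x ord0 j| <= h / d.+1%:R.
  have : 0 < h / d.+1%:R by rewrite divr_gt0.
  move: (h / _) => g g0.
  have /rat_in_itvoo[q] : x ord0 j - g < x ord0 j + g by lra.
  by rewrite in_itv/= => /andP[? ?]; exists q; rewrite ler_norml; lra.
have px : edist (map_mx ratr (\row_j q j)) x < h.
  apply: (@le_lt_trans _ _ (d%:R * (h / d.+1%:R))).
    apply: enorm_le_coord => [|j]; first by rewrite divr_ge0// ltW.
    by rewrite !mxE.
  by rewrite mulrCA gtr_pMr// ltr_pdivrMr// mul1r ltr_nat.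
exists (\row_j q j, k); split=> // y; rewrite /ratball /= => py.
apply: le_lt_trans (edist_triangle (map_mx ratr (\row_j q j)) _ _) _.
by apply: lt_trans he; rewrite edistC ltrD.
Qed.

Definition near_pair B (s : R) : set (conf B) :=
  [set xi | exists x y, [/\ pts xi x, pts xi y, x <> y & edist x y < s]].

Lemma measurable_near_pair s B : borel B -> measurable (@near_pair B s).
Proof.
move=> bB.
pose good (ij : ('rV[rat]_d * nat) * ('rV[rat]_d * nat)) := forall x y,
  ratball ij.1 x -> ratball ij.2 y -> x <> y /\ edist x y < s.
pose F ij : set (conf B) := if `[< good ij >]
  then hitting (ratball ij.1) `&` hitting (ratball ij.2) else set0.
rewrite (_ : near_pair s = \bigcup_ij F ij); last first.
  apply/seteqP; split=> xi.
    move=> [x [y [xix xiy xy xys]]].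
    have xy0 := edist_gt0 xy.
    (* The first bound keeps the two balls disjoint, the second keeps all their pairs closer than
       [s]. *)
    pose e := Num.min (edist x y / 2) ((s - edist x y) / 2).
    have e0 : 0 < e by rewrite lt_min !divr_gt0// subr_gt0.
    have e1 : e <= edist x y / 2 by rewrite ge_min lexx.
    have e2 : e <= (s - edist x y) / 2 by rewrite ge_min lexx orbT.
    have [i [ix iU]] := ratball_base x e0; have [j [jy jU]] := ratball_base y e0.
    exists (i, j) => //; rewrite /F asboolT//; first by split; [exists x|exists y].
    move=> u v /iU /= xu /jU /= yv.
    have t1 := edist_triangle u x y; have t2 := edist_triangle v u y.
    have t3 := edist_triangle x u v; have t4 := edist_triangle y x v.
    have uE := edistC u x; have vE := edistC v y; split; last lra.
    by move=> uv; rewrite uv in t1 xu; clear uv xy; lra.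
  move=> [ij _]; rewrite /F; case: asboolP => // gij [[x [? ix]] [y [? jy]]].
  by have [? ?] := gij _ _ ix jy; exists x, y.
apply: countable_bigcupT_measurable; first exact: countableP.
move=> ij; rewrite /F; case: ifP => // _.
by apply: measurableI; apply: measurable_hitting => //; apply: borel_open;
  exact: open_eball.
Qed.

Definition exclusion_zone (r : R) C : set V := [set y | exists2 x, C x & edist x y <= r].

Lemma borel_bigcup_seq (T : choiceType) (s : seq T) (F : T -> set V) :
  (forall i, borel (F i)) -> borel (\bigcup_(i in [set` s]) F i).
Proof.
move=> bF; elim: s => [|i s IH].
  by rewrite set_nil bigcup_set0; exact: borel0.
rewrite (_ : [set` i :: s] = i |` [set` s]); last first.
  by apply/seteqP; split=> j /=; rewrite inE => /predU1P.
by rewrite bigcup_setU1; apply: borelU.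
Qed.

Lemma borel_exclusion_zone r C : locally_finite C -> borel (exclusion_zone r C).
Proof.
move=> lfC.
rewrite (_ : exclusion_zone r C = \bigcup_n
    \bigcup_(x in C `&` eball0 n%:R) [set y | edist x y <= r]); last first.
  apply/seteqP; split=> y; last by move=> [n _ [x [Cx _] xy]]; exists x.
  move=> [x Cx xy]; have : [set: V] x by [].
  by rewrite -eball0_exhaust => -[n _ xn]; exists n => //; exists x.
apply: borel_bigcup => n.
have /finite_seqP[s ->] := lfC _ (ebounded_eball0 n%:R).
by apply: borel_bigcup_seq => x; apply: borel_closed; exact: closed_eball.
Qed.

(* Strict near pairs form an open condition on pairs, hence a countable union of
   hitting events; as configurations in a bounded set are finite, the closed
   condition [edist x y <= r] is the intersection over [r + 1/(n+1)]. *)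
Lemma measurable_hard_sphere r B C : bborel B -> locally_finite C ->
  measurable [set xi : conf B | hard_sphere r (pts xi) C].
Proof.
move=> [bB bdB] lfC.
rewrite (_ : [set xi | _] = ~` (\bigcap_n near_pair (r + n.+1%:R^-1))
    `&` missing (exclusion_zone r C)); last first.
  apply/seteqP; split=> xi; rewrite /hard_sphere/=.
    move=> [h1 h2]; split; last first.
      rewrite /missing/=; apply/seteqP; split=> // y [xiy [x Cx xy]].
      by have := h2 x y Cx xiy; rewrite ltNge xy.
    have [lf sB] := confP xi.
    have finxi : finite_set (pts xi) by rewrite -(setIidl sB); exact: lf.
    pose S := (pts xi `*` pts xi) `&` [set t | t.1 <> t.2].
    have finS : finite_set S by apply: finite_setIl; exact: finite_setX.
    have [[x y] [[xix xiy] xy]|e e0 he] :=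
        @finite_gap R _ S (fun t => edist t.1 t.2) r finS.
      exact: h1.
    move=> /(_ (Num.truncn e^-1) I)[x [y [xix xiy xy]]].
    have := he (x, y) (conj (conj xix xiy) xy) => /= le1.
    rewrite ltNge => /negP; apply; apply: le_trans le1; rewrite lerD2l.
    by rewrite -[leRHS]invrK lef_pV2 ?posrE ?invr_gt0// ltW// truncnS_gt.
  move=> [h1 h2]; split=> [x y xix xiy xy|x y Cx xiy]; rewrite ltNge; apply/negP => le.
    apply: h1 => n _; exists x, y; split=> //; apply: le_lt_trans le _.
    by rewrite ltrDl invr_gt0.
  have : set0 y by rewrite -h2; split=> //; exists x.
  by [].
apply: measurableI.
  apply: measurableC; apply: bigcapT_measurable => n.
  exact: measurable_near_pair.
by apply: measurable_missing => //; exact: borel_exclusion_zone.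
Qed.

(** Chain rule behind all conditioning: exclusion between [X] and [Y] is charged to [X], with [Y]
    joining its boundary condition. Disjointness turns a pair from [X] and [Y] into a pair of
    distinct points. *)
Lemma hard_sphereU r X Y C : X `&` Y = set0 ->
  hard_sphere r (X `|` Y) C <-> hard_sphere r Y C /\ hard_sphere r X (C `|` Y).
Proof.
move=> XY0; split.
  move=> [h1 h2]; split; split.
  - by move=> x y Yx Yy; apply: h1; right.
  - by move=> x y Cx Yy; apply: h2 => //; right.
  - by move=> x y Xx Xy; apply: h1; left.
  - move=> x y [Cx|Yx] Xy; first by apply: h2 => //; left.
    apply: h1; [by right|by left|] => xy.
    by have : set0 y by rewrite -XY0; split=> //; rewrite -xy.
move=> [[h1 h2] [h3 h4]]; split.
  move=> x y [Xx|Yx] [Xy|Yy] xy.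
  - exact: h3.
  - by rewrite edistC; apply: h4 => //; right.
  - by apply: h4 => //; right.
  - exact: h1.
move=> x y Cx [Xy|Yy]; last exact: h2.
by apply: h4 => //; left.
Qed.

End HardSphereEvent.

(** * Disagreement couplings *)

Section MeasureBounds.
Local Open Scope ereal_scope.

Lemma ae_le_measure d (T : measurableType d) (R : realType)
    (P : {measure set T -> \bar R}) (A B : set T) :
  measurable A -> measurable B -> {ae P, forall t, A t -> B t} -> P A <= P B.
Proof.
move=> mA mB [N [mN N0 hN]].
have ABN : A `<=` B `|` N.
  move=> t At; have [Bt|nBt] := pselect (B t); first by left.
  by right; apply: hN => /= /(_ At).
apply: (@le_trans _ _ (P (B `|` N))).
  by rewrite le_measure ?inE//; exact: measurableU.
apply: le_trans (measureU2 _ _ _) _ => //.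
by rewrite -[leRHS]adde0 leeD// -N0.
Qed.

(** [P A - P B] is at most [P (A]\[B)], so one-sided bounds yield the absolute value without a
    factor 2. *)
Lemma abs_measure_sub_le d (T : measurableType d) (R : realType)
    (P : probability T R) (A B : set T) (b : \bar R) :
  measurable A -> measurable B -> P (A `\` B) <= b -> P (B `\` A) <= b ->
  `|P A - P B| <= b.
Proof.
move=> mA mB.
have main (X Y : set T) : measurable X -> measurable Y -> P (X `\` Y) <= b ->
    P X - P Y <= b.
  move=> mX mY hb; rewrite leeBlDr ?fin_num_measure//.
  apply: (@le_trans _ _ (P (X `\` Y) + P Y)); last exact: leeD.
  rewrite -measureU//; [|exact: measurableD|by apply/seteqP; split=> // t [[]]].
  rewrite le_measure ?inE//; first by apply: measurableU => //; exact: measurableD.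
  by move=> t Xt; have [Yt|nYt] := pselect (Y t); [right|left].
move=> hAB hBA.
have fA := fin_num_measure P A mA; have fB := fin_num_measure P B mB.
have := main _ _ mA mB hAB; have := main _ _ mB mA hBA.
rewrite -(fineK fA) -(fineK fB); move: (fine _) (fine _) => a c.
case: b {main hAB hBA} => [b| |] //.
- by rewrite -!EFinB abse_EFin !lee_fin => ? ?; rewrite ler_norml; lra.
- by rewrite !leey.
Qed.

End MeasureBounds.

Section DisagreementBound.
Local Open Scope ereal_scope.
Context {R : realType} {d : nat}.
Local Notation V := 'rV[R]_d.
Implicit Types (A B C D L W : set V).
Variables (r alpha lambda : R).
Variable Ppoi : probability (conf [set: V]) R.
Hypothesis hPpoi : is_poisson alpha Ppoi.

Definition connect_bound A D : \bar R :=
  (Ppoi^*)%mu [set xi | set_connected r (pts xi) A D].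

Lemma set_connectedS C C' A D :
  C `<=` C' -> set_connected r C A D -> set_connected r C' A D.
Proof.
move=> CC' [x [y [Ax Dy [s sC ps]]]]; exists x, y; split=> //.
by exists s => // z /sC/CC'.
Qed.

(* The relevant configurations live on [W] whereas [Ppoi] lives on the whole
   space: a Poisson configuration outside [W], independent of the one inside,
   can only help to connect. *)
Lemma connect_bound_ge W (Q : probability (conf W) R) (b : \bar R) A D :
  0 <= b -> borel W -> is_poisson alpha Q ->
  (forall S, measurable S ->
    (forall xi, set_connected r (pts xi) A D -> S xi) -> b <= Q S) ->
  b <= connect_bound A D.
Proof.
(* The outer measure is an infimum over countable measurable covers [F], so it suffices to bound the
   union of one cover from below. *)
move=> b0 bW hQ hb; apply: le_ereal_inf_tmp => _ [F [mF cF] <-].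
have mU : measurable (\bigcup_k F k) by exact: bigcup_measurable.
apply: (@le_trans _ _ (Ppoi (\bigcup_k F k))); last first.
  exact: measure_sigma_subadditive.
have [Q1 [Q1E _]] := exists_image_law Ppoi (measurable_restr (borelC bW) (@borelT R d)).
have [Q2 [Q2E _]] := exists_image_law Ppoi (measurable_restr bW (@borelT R d)).
have [mf ->] := poisson_fubini (borelC bW) bW (setICl W) (setvU W) hPpoi Q1E Q2E mU.
have QQ2 S : measurable S -> Q S = Q2 S.
  apply: conf_law_unique; [exact: probability_setT|exact: probability_setT|].
  move=> A' bA' A'W; apply: (etrans _ (esym (Q2E _))).
  apply: (etrans (poisson_void hQ bA' A'W)).
  rewrite -(poisson_void hPpoi)//; congr (Ppoi _).
  apply/seteqP; split=> xi; rewrite /missing/= -setIA;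
    by rewrite (_ : W `&` A' = A')//; exact/setIidPr.
have mS (eta : conf (~` W)) :
    measurable [set xi : conf W | (\bigcup_k F k) (glue setT (eta, xi))].
  exact: measurable_glue_section (@borelT R d) (borelC bW) bW mU.
(* Read [b] as the integral of a constant under [Q1]. For each frozen [eta] outside [W], the section
   of the cover contains the connection event on [W], so [hb] applies to it. *)
rewrite -[b]mule1 -(probability_setT Q1) -integral_cst//.
apply: ge0_le_integral => // eta _.
apply: (@le_trans _ _ (Q [set xi | (\bigcup_k F k) (glue setT (eta, xi))])).
  apply: hb => // xi hxi; apply: cF; apply: set_connectedS hxi.
  by move=> x xix; split=> //; right.
by rewrite QQ2.
Qed.

Lemma connect_bound_ge0 A D : 0 <= connect_bound A D.
Proof. exact: mu_ext_ge0. Qed.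

(** The last vertex before the target is [y] or a point of [S], hence in [W]. So only the part of
    [C] within one jump of [W] matters, and [D] may replace [C]. *)
Lemma set_connected_target W S (C : set V) D y :
  (forall w z, W w -> C z -> (edist w z <= r)%R -> D z) ->
  W y -> S `<=` W -> set_connected r S [set y] C ->
  exists z, D z /\ pt_connected r S y z.
Proof.
move=> hD Wy SW [_ [z [-> Cz yz]]]; exists z; split=> //.
have [s sS] := yz; rewrite rcons_path => /andP[_ last_z].
apply: hD last_z => //; have := mem_last y s; rewrite inE => /predU1P[->//|ls].
exact/SW/sS.
Qed.

(** Different restrictions to [A] exhibit a disagreement point in [A]. Almost surely it is joined to
    [C1]+[C2] by disagreement points, all of which belong to the Poisson component. *)
Lemma coupling_event_bound W C1 C2 A D
    (P : probability (conf W * conf W * conf W)%type R)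
    (N : set (conf W * conf W * conf W)) :
  disagreement_coupling r alpha lambda C1 C2 P -> borel W -> A `<=` W ->
  (forall w z, W w -> (C1 `+` C2) z -> (edist w z <= r)%R -> D z) ->
  measurable N -> (forall t, N t -> restr A t.1.1 <> restr A t.1.2) ->
  P N <= connect_bound A D.
Proof.
move=> [_ _ hP3 hsub hconn] bW AW hD mN hN.
have [Q [QE _]] := exists_image_law P
  (@measurable_snd _ _ (conf W * conf W)%type (conf W)).
have hQ : is_poisson alpha Q.
  by move=> k F n hF tF; apply: (etrans (QE _)); exact: hP3.
apply: (connect_bound_ge _ bW hQ) => // S mS hS; rewrite QE.
apply: ae_le_measure => //.
  by rewrite -[X in measurable X]setTI; exact: measurable_snd.
apply: filterS2 hsub hconn => t sub conn Nt; apply: hS.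
have [y [Ay sy]] : exists y, A y /\ (pts t.1.1 `+` pts t.1.2) y.
  apply: contrapT => h; apply: (hN t Nt); apply: conf_eq => /=.
  apply/seteqP; split=> y [xiy Ay]; split=> //; apply: contrapT => nxiy;
    by apply: h; exists y; split=> //; first [by left|by right].
have [_ W1] := confP t.1.1; have [_ W2] := confP t.1.2.
have sW : pts t.1.1 `+` pts t.1.2 `<=` W by move=> z [[/W1]|[/W2]].
have [z [Dz yz]] := set_connected_target hD (AW _ Ay) sW (conn y sy).
by apply: (set_connectedS sub); exists y, z.
Qed.

Lemma coupling_bound W C1 C2 A D
    (P : probability (conf W * conf W * conf W)%type R) (E : set (conf A)) :
  disagreement_coupling r alpha lambda C1 C2 P -> borel W -> borel A -> A `<=` W ->
  (forall w z, W w -> (C1 `+` C2) z -> (edist w z <= r)%R -> D z) ->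
  measurable E ->
  `|P [set t | E (restr A t.1.1)] - P [set t | E (restr A t.1.2)]|
    <= connect_bound A D.
Proof.
move=> hP bW bA AW hD mE.
have mE' := measurable_restr_preimage bA bW mE.
have m1 : measurable [set t : conf W * conf W * conf W | E (restr A t.1.1)].
  rewrite -[X in measurable X]setTI.
  have m11 : measurable_fun setT (fun t : conf W * conf W * conf W => t.1.1).
    exact: measurableT_comp.
  exact: (m11 measurableT _ mE').
have m2 : measurable [set t : conf W * conf W * conf W | E (restr A t.1.2)].
  rewrite -[X in measurable X]setTI.
  have m12 : measurable_fun setT (fun t : conf W * conf W * conf W => t.1.2).
    exact: measurableT_comp.
  exact: (m12 measurableT _ mE').
apply: abs_measure_sub_le => //; apply: (coupling_event_bound hP) => //;
  try exact: measurableD.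
- by move=> t [? nE] eE; apply: nE; rewrite /= -eE.
- by move=> t [? nE] eE; apply: nE; rewrite /= eE.
Qed.

(** Hard-sphere laws are given by a predicate; this identifies a given law with the marginal of a
    coupling. *)
Lemma hs_unique B C (m1 m2 : set (conf B) -> \bar R) S :
  is_hs r C lambda m1 -> is_hs r C lambda m2 ->
  bborel B -> locally_finite C -> measurable S -> m1 S = m2 S.
Proof.
move=> [Q1 hQ1 h1] [Q2 hQ2 h2] bB lfC mS; rewrite h1// h2//.
have Q12 S' : measurable S' -> Q1 S' = Q2 S'.
  apply: conf_law_unique; [exact: probability_setT|exact: probability_setT|].
  move=> A bA AB; apply: (etrans (poisson_void hQ1 bA AB)).
  exact: esym (poisson_void hQ2 bA AB).
have mH := measurable_hard_sphere r bB lfC.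
by rewrite !Q12//; exact: measurableI.
Qed.

(** [m1] and [m2] are mere set functions so that conditional laws, which arise as quotients, can be
    used directly. *)
Lemma hs_coupling W C1 C2 A D (m1 m2 : set (conf W) -> \bar R) (E : set (conf A)) :
  (exists P, @disagreement_family R d r alpha lambda P) ->
  bborel W -> configs (~` W) C1 -> configs (~` W) C2 ->
  borel A -> A `<=` W ->
  (forall w z, W w -> (C1 `+` C2) z -> (edist w z <= r)%R -> D z) ->
  is_hs r C1 lambda m1 -> is_hs r C2 lambda m2 -> measurable E ->
  `|m1 (restr A @^-1` E) - m2 (restr A @^-1` E)| <= connect_bound A D.
Proof.
move=> [P hP] bW hC1 hC2 bA AW hD h1 h2 mE.
have hPW := hP W C1 C2 bW hC1 hC2; have [hP1 hP2 _ _ _] := hPW.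
have mE' := measurable_restr_preimage bA bW.1 mE.
rewrite (hs_unique h1 hP1 bW hC1.1 mE') (hs_unique h2 hP2 bW hC2.1 mE').
exact: (coupling_bound hPW bW.1 bA AW hD mE).
Qed.

End DisagreementBound.

(** * Spatial mixing in finite volume *)

(** Clears the normalizing constant, which varies with the boundary condition: the resulting linear
    inequalities can be integrated over it. [scaled_ratio_bound] divides again afterwards. *)
Lemma ratio_bounds (R : realFieldType) (a b p e : R) :
  0 < b -> - e <= a / b - p -> a / b - p <= e ->
  a <= (p + e) * b /\ p * b <= a + e * b.
Proof.
move=> b0 h1 h2; have aE : a / b * b = a by rewrite divfK// gt_eqF.
split; first by rewrite -[a]aE ler_pM2r//; lra.
by rewrite -[a]aE -mulrDl ler_pM2r//; lra.
Qed.

Lemma scaled_ratio_bound (R : realFieldType) (a t h p e : R) : 0 < h ->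
  a <= (p + e) * t -> p * t <= a + e * t ->
  `|a / h - p * (t / h)| <= e * (t / h).
Proof.
move=> h0 h1 h2; have hi : 0 < h^-1 by rewrite invr_gt0.
by rewrite !mulrA -mulrBl normrM (gtr0_norm hi) ler_pM2r// ler_norml; lra.
Qed.

(** Real-valued, so that [lra] and limits of real sequences apply; [prE] leads back. *)
Definition pr d (T : measurableType d) (R : realType) (P : probability T R)
  (X : set T) : R := fine (P X).

Section RealProbability.
Local Open Scope ereal_scope.
Context d (T : measurableType d) (R : realType) (P : probability T R).
Implicit Types X Y : set T.

Lemma prE X : measurable X -> P X = (pr P X)%:E.
Proof. by move=> mX; rewrite /pr fineK// fin_num_measure. Qed.

Lemma pr_ge0 X : (0 <= pr P X)%R.
Proof. by rewrite fine_ge0. Qed.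

Lemma pr_le1 X : measurable X -> (pr P X <= 1)%R.
Proof. by move=> mX; rewrite -lee_fin -prE// probability_le1. Qed.

Lemma le_pr X Y : measurable X -> measurable Y -> X `<=` Y -> (pr P X <= pr P Y)%R.
Proof. by move=> mX mY XY; rewrite -lee_fin -!prE// le_measure ?inE. Qed.

Lemma prC X : measurable X -> (pr P (~` X) = 1 - pr P X)%R.
Proof.
move=> mX; apply: EFin_inj; rewrite EFinB -!prE//; last exact: measurableC.
by rewrite probability_setC.
Qed.

Lemma prT : pr P setT = 1%R.
Proof. by apply: EFin_inj; rewrite -prE// probability_setT. Qed.

Lemma prU X Y : measurable X -> measurable Y -> X `&` Y = set0 ->
  (pr P (X `|` Y) = pr P X + pr P Y)%R.
Proof.
move=> mX mY XY; apply: EFin_inj; rewrite EFinD -!prE//; last exact: measurableU.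
by rewrite measureU.
Qed.

End RealProbability.

Section HardSphereMixing.
Local Open Scope ereal_scope.
Context {R : realType} {d : nat}.
Local Notation V := 'rV[R]_d.
Implicit Types (A B C D L W : set V).
Variables (r lambda : R).

Lemma poisson_restr lam L W (Q : set (conf L) -> \bar R) (Q' : set (conf W) -> \bar R) :
  W `<=` L -> is_poisson lam Q -> (forall S, Q' S = Q (restr W @^-1` S)) ->
  is_poisson lam Q'.
Proof.
move=> WL hQ Q'E k F n hF tF; rewrite Q'E -(hQ k F n)//; last first.
  by move=> i; have [? FW] := hF i; split=> //; exact: subset_trans WL.
congr Q; apply/seteqP; split=> xi /= h i; have [_ FW] := hF i;
  have := h i; rewrite -setIA (_ : W `&` F i = F i)//; exact/setIidPr.
Qed.

(** The empty configuration is admissible and has positive probability in a bounded set. *)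
Lemma poisson_hard_sphere_gt0 B C (Q : probability (conf B) R) :
  is_poisson lambda Q -> bborel B -> locally_finite C ->
  (0 < pr Q [set xi : conf B | hard_sphere r (pts xi) C])%R.
Proof.
move=> hQ bB lfC; rewrite -lte_fin -prE; last exact: measurable_hard_sphere.
apply: (@lt_le_trans _ _ (Q (missing B))).
  by rewrite (poisson_void hQ)// lte_fin expR_gt0.
rewrite le_measure ?inE//.
- exact: measurable_missing bB.1 bB.1.
- exact: measurable_hard_sphere.
- move=> xi /= xiB; have [_ sB] := confP xi.
  have xi0 x : ~ pts xi x.
    by move=> xix; have : set0 x by rewrite -xiB; split=> //; exact: sB.
  by split=> [x y /xi0|x y _ /xi0].
Qed.

Section Mixing.
Variables (L W1 W2 C : set V) (Q : probability (conf L) R)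
  (Q1 : probability (conf W1) R) (Q2 : probability (conf W2) R).
Hypotheses (bL : bborel L) (bW1 : borel W1) (bW2 : borel W2)
  (W120 : W1 `&` W2 = set0) (W12L : W1 `|` W2 = L) (lfC : locally_finite C)
  (hQ : is_poisson lambda Q)
  (Q1E : forall S, Q1 S = Q (restr W1 @^-1` S))
  (Q2E : forall S, Q2 S = Q (restr W2 @^-1` S)).

Let H := [set xi : conf L | hard_sphere r (pts xi) C].
Let H1 := [set eta : conf W1 | hard_sphere r (pts eta) C].
Let H2 (eta : conf W1) :=
  [set xi : conf W2 | hard_sphere r (pts xi) (C `|` pts eta)].

(** By [hard_sphereU] the conditions on [eta] alone separate from those on [xi], so each section is
    either empty or [E]&[H2 eta]. *)
Lemma mixing_section (E : set (conf W2)) (F : set (conf W1)) (eta : conf W1) :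
  [set xi | (restr W2 @^-1` E `&` restr W1 @^-1` F `&` H) (glue L (eta, xi))] =
  [set xi | (E xi /\ H2 eta xi) /\ (F eta /\ H1 eta)].
Proof.
have [_ s1] := confP eta; apply/seteqP.
have K (xi : conf W2) : [/\ restr W2 (glue L (eta, xi)) = xi,
    restr W1 (glue L (eta, xi)) = eta &
    H (glue L (eta, xi)) <-> H1 eta /\ H2 eta xi].
  have [_ s2] := confP xi.
  have gE : (pts eta `|` pts xi) `&` L = pts eta `|` pts xi.
    by apply/setIidPl; rewrite -W12L; apply: setUSS.
  have eW2 : pts eta `&` W2 = set0.
    by apply/seteqP; split=> // x [/s1 ? ?]; rewrite -W120.
  have xW1 : pts xi `&` W1 = set0.
    by apply/seteqP; split=> // x [/s2 ? ?]; rewrite -W120.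
  split.
  - by apply: conf_eq; rewrite /= gE setIUl eW2 set0U; exact/setIidPl.
  - by apply: conf_eq; rewrite /= gE setIUl xW1 setU0; exact/setIidPl.
  - rewrite /H/H1/H2/= gE setUC; apply: hard_sphereU.
    by apply/seteqP; split=> // x [/s2 ? /s1 ?]; rewrite -W120.
split=> xi /=; have [-> -> HE] := K xi.
  by move=> [[Exi Feta] /HE[h1 h2]].
by move=> [[Exi h2] [Feta h1]]; split=> //; apply/HE.
Qed.

Lemma mixing_le (E : set (conf W2)) (F : set (conf W1)) (p e : R) :
  (0 <= p)%R -> (0 <= e)%R -> measurable E -> measurable F ->
  (forall eta, pr Q2 (E `&` H2 eta) <= (p + e) * pr Q2 (H2 eta) /\
     p * pr Q2 (H2 eta) <= pr Q2 (E `&` H2 eta) + e * pr Q2 (H2 eta))%R ->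
  let S := restr W2 @^-1` E `&` restr W1 @^-1` F `&` H in
  let T := restr W1 @^-1` F `&` H in
  (pr Q S <= (p + e) * pr Q T /\ p * pr Q T <= pr Q S + e * pr Q T)%R.
Proof.
move=> p0 e0 mE mF h S T.
have mH : measurable H by exact: measurable_hard_sphere.
have mT : measurable T.
  by apply: measurableI => //; exact: measurable_restr_preimage bL.1 mF.
have mS : measurable S.
  rewrite /S -setIA; apply: measurableI => //.
  exact: measurable_restr_preimage bL.1 mE.
have [mfS QS] := poisson_fubini bW1 bW2 W120 W12L hQ Q1E Q2E mS.
have [mfT QT] := poisson_fubini bW1 bW2 W120 W12L hQ Q1E Q2E mT.
(* Viewing [T] as the case [E = setT] lets [mixing_section] describe both sections. *)
have TE : T = restr W2 @^-1` setT `&` restr W1 @^-1` F `&` H by rewrite setTI.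
have hh (eta : conf W1) : Q2 [set xi | S (glue L (eta, xi))] <=
    (p + e)%:E * Q2 [set xi | T (glue L (eta, xi))] /\
    p%:E * Q2 [set xi | T (glue L (eta, xi))] <=
    Q2 [set xi | S (glue L (eta, xi))] + e%:E * Q2 [set xi | T (glue L (eta, xi))].
  have -> : Q2 [set xi | S (glue L (eta, xi))] =
      Q2 [set xi | (E xi /\ H2 eta xi) /\ (F eta /\ H1 eta)].
    by congr (Q2 _); exact: mixing_section.
  have -> : Q2 [set xi | T (glue L (eta, xi))] =
      Q2 [set xi | ([set: conf W2] xi /\ H2 eta xi) /\ (F eta /\ H1 eta)].
    by congr (Q2 _); rewrite TE; exact: mixing_section.
  have [FH|nFH] := pselect (F eta /\ H1 eta).
    have -> : [set xi | (E xi /\ H2 eta xi) /\ (F eta /\ H1 eta)] = E `&` H2 eta.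
      by apply/seteqP; split=> xi; [case|split].
    have -> : [set xi | ([set: conf W2] xi /\ H2 eta xi) /\ (F eta /\ H1 eta)] = H2 eta.
      by apply/seteqP; split=> xi; [case=> -[]|split].
    have mH2 : measurable (H2 eta).
      apply: measurable_hard_sphere.
        by split=> //; apply: ebounded_sub bL.2; rewrite -W12L; exact: subsetUr.
      by apply: locally_finiteU => //; have [] := confP eta.
    have [h1 h2] := h eta; split.
      by rewrite (prE _ mH2) prE ?lee_fin//; exact: measurableI.
    by rewrite (prE _ mH2) prE ?lee_fin//; exact: measurableI.
  have -> : [set xi | (E xi /\ H2 eta xi) /\ (F eta /\ H1 eta)] = set0.
    by apply/seteqP; split=> xi // [_ /nFH].
  have -> : [set xi | ([set: conf W2] xi /\ H2 eta xi) /\ (F eta /\ H1 eta)] = set0.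
    by apply/seteqP; split=> xi // [_ /nFH].
  by rewrite !measure0 !mule0 adde0.
have pe0 : (0 <= p + e)%R by exact: addr_ge0.
suff : Q S <= (p + e)%:E * Q T /\ p%:E * Q T <= Q S + e%:E * Q T.
  by rewrite !prE.
rewrite QS QT; split.
  rewrite -ge0_integralZl//; apply: ge0_le_integral => //.
  - exact: measurable_funeM.
  - by move=> eta _; have [] := hh eta.
rewrite -!ge0_integralZl// -ge0_integralD//; last 2 first.
- by move=> eta _; rewrite mule_ge0.
- exact: measurable_funeM.
apply: ge0_le_integral => //.
- by move=> eta _; rewrite mule_ge0.
- exact: measurable_funeM.
- by apply: emeasurable_funD => //; exact: measurable_funeM.
- by move=> eta _; have [] := hh eta.
Qed.

End Mixing.

(** Averaging over the configuration in [W1]: if every conditional probability of [E] is within [e]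
    of [p], the error on an event of [W1] is at most [e] times the probability of that event. *)
Lemma hs_mixing L W1 W2 C A (mL : set (conf L) -> \bar R) (E : set (conf A))
    (F : set (conf W1)) (p e : R) :
  bborel L -> borel W1 -> borel W2 -> W1 `&` W2 = set0 -> W1 `|` W2 = L ->
  locally_finite C -> is_hs r C lambda mL -> borel A -> A `<=` W2 ->
  (0 <= p)%R -> (0 <= e)%R -> measurable E -> measurable F ->
  (forall (eta : conf W1) (m : set (conf W2) -> \bar R),
     is_hs r (C `|` pts eta) lambda m -> `|m (restr A @^-1` E) - p%:E| <= e%:E) ->
  `|mL (restr A @^-1` E `&` restr W1 @^-1` F) - p%:E * mL (restr W1 @^-1` F)|
    <= e%:E * mL (restr W1 @^-1` F).
Proof.
move=> bL bW1 bW2 W120 W12L lfC [Q hQ hmL] bA AW2 p0 e0 mE mF hm.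
have [Q1 [Q1E _]] := exists_image_law Q (measurable_restr bW1 bL.1).
have [Q2 [Q2E _]] := exists_image_law Q (measurable_restr bW2 bL.1).
have W2L : W2 `<=` L by rewrite -W12L; exact: subsetUr.
have hQ2 : is_poisson lambda Q2 by exact: (poisson_restr W2L hQ).
have bbW2 : bborel W2 by split=> //; exact: ebounded_sub W2L bL.2.
have mE2 := measurable_restr_preimage bA bW2 mE.
pose H := [set xi : conf L | hard_sphere r (pts xi) C].
have key (X : set (conf L)) : X = restr W2 @^-1` (restr A @^-1` E) ->
    (pr Q (X `&` restr W1 @^-1` F `&` H) <= (p + e) * pr Q (restr W1 @^-1` F `&` H) /\
    p * pr Q (restr W1 @^-1` F `&` H) <=
    pr Q (X `&` restr W1 @^-1` F `&` H) + e * pr Q (restr W1 @^-1` F `&` H))%R.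
  move=> ->; apply: (mixing_le bL bW1 bW2 W120 W12L lfC hQ Q1E Q2E p0 e0 mE2 mF).
  move=> eta; set H2 := [set xi : conf W2 | hard_sphere _ _ _].
  have lfCe : locally_finite (C `|` pts eta).
    by apply: locally_finiteU => //; have [] := confP eta.
  have Q2H : (0 < pr Q2 H2)%R by exact: poisson_hard_sphere_gt0.
  have hs2 : is_hs r (C `|` pts eta) lambda
      (fun X => (pr Q2 (X `&` H2) / pr Q2 H2)%:E) by exists Q2.
  have := hm eta _ hs2.
  rewrite -EFinB abse_EFin lee_fin ler_norml => /andP[h1 h2].
  exact: ratio_bounds.
have QH : (0 < pr Q H)%R by exact: poisson_hard_sphere_gt0.
have mF' := measurable_restr_preimage bW1 bL.1 mF.
have mE' := measurable_restr_preimage bA bL.1 mE.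
rewrite !hmL//; last exact: measurableI.
have [] := key (restr A @^-1` E).
  by apply/seteqP; split=> xi; rewrite /preimage/= restr_restr.
rewrite -!EFinM -EFinB abse_EFin lee_fin => h1 h2.
exact: scaled_ratio_bound QH h1 h2.
Qed.

End HardSphereMixing.

(** * Finite-volume comparison and decorrelation *)

Section FiniteVolume.
Local Open Scope ereal_scope.
Context {R : realType} {d : nat}.
Local Notation V := 'rV[R]_d.
Implicit Types (A B C D L W : set V).
Variables (r alpha lambda : R).
Variable Ppoi : probability (conf [set: V]) R.
Hypothesis hPpoi : is_poisson alpha Ppoi.
Hypothesis hfam : exists P, @disagreement_family R d r alpha lambda P.

Lemma configsU B C C' : configs B C -> configs B C' -> configs B (C `|` C').
Proof.
move=> [? CB] [? C'B]; split; first exact: locally_finiteU.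
by rewrite subUset.
Qed.

Lemma configs_conf B W (eta : conf W) : W `<=` B -> configs B (pts eta).
Proof. by move=> WB; have [? s] := confP eta; split=> //; exact: subset_trans WB. Qed.

Lemma configsS B B' C : B `<=` B' -> configs B C -> configs B' C.
Proof. by move=> BB' [? s]; split=> //; exact: subset_trans BB'. Qed.

(* Given the configuration in [L `\` W], the restriction to [W] is a hard-sphere
   law whose boundary condition differs from [C'] only outside [W]. *)
Lemma hs_volume_compare L W C C' A D (mL : probability (conf L) R)
    (mW : probability (conf W) R) (E : set (conf A)) (e : R) :
  bborel L -> borel W -> W `<=` L -> configs (~` L) C -> configs (~` W) C' ->
  is_hs r C lambda mL -> is_hs r C' lambda mW -> borel A -> A `<=` W ->
  (forall w z, W w -> ~ W z -> (edist w z <= r)%R -> D z) ->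
  connect_bound r Ppoi A D <= e%:E -> measurable E ->
  `|mL (restr A @^-1` E) - mW (restr A @^-1` E)| <= e%:E.
Proof.
move=> bL bW WL hC hC' hmL hmW bA AW hD he mE.
have e0 : (0 <= e)%R by rewrite -lee_fin (le_trans _ he)// connect_bound_ge0.
have mEW := measurable_restr_preimage bA bW mE.
have bbW : bborel W by split=> //; exact: ebounded_sub WL bL.2.
have dis : (L `\` W) `&` W = set0 by rewrite setDE -setIA setICl setI0.
have := hs_mixing bL (borelD bL.1 bW) bW dis (setDKU WL) hC.1 hmL bA AW
  (pr_ge0 mW (restr A @^-1` E)) e0 mE (@measurableT _ _).
rewrite preimage_setT setIT -(prE _ mEW) probability_setT !mule1; apply.
move=> eta m hm; apply: le_trans he.
apply: (hs_coupling hPpoi hfam bbW _ hC' bA AW) hm hmW mE.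
  apply: configsU; last by apply: configs_conf => x [].
  by apply: configsS hC; exact: subsetC.
have [_ CL] := hC; have [_ CW'] := hC'; have [_ sL] := confP eta.
move=> w z Ww CCz; apply: hD => // Wz.
case: CCz => [[[/CL nLz|/sL[_ nWz]] _]|[/CW' nWz _]]; [|exact: nWz|exact: nWz].
by apply: nLz; exact: WL.
Qed.

(* Conditional laws given two configurations in [B] have boundary conditions that
   differ only in [B]; averaging over one of them compares the conditional law
   with [mL]. *)
Lemma hs_decorrelation L A B C (mL : probability (conf L) R) (E : set (conf A))
    (F : set (conf B)) (e : R) :
  bborel L -> borel A -> borel B -> A `<=` L -> B `<=` L -> A `&` B = set0 ->
  configs (~` L) C -> is_hs r C lambda mL ->
  connect_bound r Ppoi A B <= e%:E -> measurable E -> measurable F ->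
  `|mL (restr A @^-1` E `&` restr B @^-1` F)
      - mL (restr A @^-1` E) * mL (restr B @^-1` F)| <= e%:E.
Proof.
move=> bL bA bB AL BL AB hC hmL he mE mF.
have e0 : (0 <= e)%R by rewrite -lee_fin (le_trans _ he)// connect_bound_ge0.
have mEL := measurable_restr_preimage bA bL.1 mE.
have mFL := measurable_restr_preimage bB bL.1 mF.
have bW : borel (L `\` B) by exact: borelD bL.1 bB.
have bbW : bborel (L `\` B) by exact: bborelD.
have AW : A `<=` L `\` B.
  by move=> x Ax; split; [exact: AL|move=> Bx; have : set0 x by rewrite -AB].
have mEW := measurable_restr_preimage bA bW mE.
have dis : B `&` (L `\` B) = set0 by apply/seteqP; split=> // x [? []].
have uni : B `|` (L `\` B) = L by rewrite setUC; exact: setDKU.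
(* Used twice: with [F' = setT] and [p] one conditional probability of [E], to compare that
   probability with [mL]; then with [F' = F] and [p] the probability of [E] under [mL]. *)
have mix (F' : set (conf B)) (p : R) (p0 : (0 <= p)%R) :=
  hs_mixing (F := F') bL bB bW dis uni hC.1 hmL bA AW p0 e0 mE.
have hCeta (eta : conf B) : configs (~` (L `\` B)) (C `|` pts eta).
  apply: configsU; last by apply: configs_conf => x ? [].
  by apply: configsS hC; apply: subsetC => x [].
have hp (eta : conf B) (m : set (conf (L `\` B)) -> \bar R) :
    is_hs r (C `|` pts eta) lambda m ->
    `|m (restr A @^-1` E) - (pr mL (restr A @^-1` E))%:E| <= e%:E.
  move=> hm; have [x x0 mE_x] : exists2 x, (0 <= x)%R & m (restr A @^-1` E) = x%:E.
    have [Q _ hmQ] := hm; eexists; last exact: hmQ.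
    by rewrite divr_ge0// fine_ge0.
  have := mix setT x x0 (@measurableT _ _).
  rewrite preimage_setT setIT probability_setT !mule1 mE_x prE//.
  rewrite -!EFinB !abse_EFin distrC; apply=> eta' m' hm'.
  rewrite -mE_x; apply: le_trans he.
  apply: (hs_coupling hPpoi hfam bbW (hCeta eta') (hCeta eta) bA AW _ hm' hm mE).
  (* The common part [C] cancels, leaving only points of [eta] or [eta'], which lie in [B]. *)
  move=> w z _ CCz _; have [_ sB] := confP eta; have [_ sB'] := confP eta'.
  case: CCz => -[[Cz|Bz] nCz].
  - by case: nCz; left.
  - exact: sB'.
  - by case: nCz; left.
  - exact: sB.
have := mix F _ (pr_ge0 mL _) mF hp.
rewrite -prE// => h; apply: (le_trans h).
rewrite -[leRHS]mule1; apply: lee_pmul => //.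
by apply: probability_le1.
Qed.

End FiniteVolume.

(** * Local convergence of Gibbs approximations *)

Section HittingRegularity.
Local Open Scope ereal_scope.
Context {R : realType} {d : nat}.
Local Notation V := 'rV[R]_d.
Implicit Types (A B D G : set V).
Variables (P : probability (conf [set: V]) R) (M : R).

(* The hitting probability is only subadditive in the set, but local finiteness
   makes it continuous along decreasing sequences with empty intersection, which
   is all that outer and inner regularity need. *)
Let hit_prob A := P (hitting (A `&` eball0 M)).

Let measurable_hit A : borel A ->
  measurable (hitting (A `&` eball0 M) : set (conf [set: V])).
Proof.
by move=> bA; apply: measurable_hitting; [exact: borelT|apply: borelI => //;
  exact: borel_eball0].
Qed.

Let le_hit A B : borel A -> borel B -> A `<=` B -> hit_prob A <= hit_prob B.
Proof.
move=> bA bB AB; apply: le_measure; rewrite ?inE; [exact: measurable_hit..|].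
by apply: hittingS => x [/AB].
Qed.

Let hit_bigcup (F : nat -> set V) : (forall i, borel (F i)) ->
  hit_prob (\bigcup_i F i) <= \sum_(i <oo) hit_prob (F i).
Proof.
move=> bF; apply: measure_sigma_subadditive => [i||].
- exact: measurable_hit.
- by apply: measurable_hit; exact: borel_bigcup.
- by rewrite setI_bigcupl hitting_bigcup.
Qed.

Let hitU A B : borel A -> borel B -> hit_prob (A `|` B) <= hit_prob A + hit_prob B.
Proof.
move=> bA bB; rewrite /hit_prob.
have -> : hitting ((A `|` B) `&` eball0 M) =
    hitting (A `&` eball0 M) `|` hitting (B `&` eball0 M) :> set (conf [set: V]).
  by rewrite setIUl !hitting_missing missingU setCI.
by apply: measureU2; exact: measurable_hit.
Qed.

(** A configuration has finitely many points in the ball and each of them eventually leaves [F], so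
    none hits every [F n]. *)
Let hit_vanish (F : nat -> set V) (e : R) : (0 < e)%R -> (forall i, borel (F i)) ->
  nonincreasing_seq F -> \bigcap_i F i = set0 -> exists n, hit_prob (F n) <= e%:E.
Proof.
move=> e0 bF ndF F0.
pose S n : set (conf [set: V]) := hitting (F n `&` eball0 M).
have mS n : measurable (S n) by exact: measurable_hit.
have S0 : \bigcap_n S n = set0.
  apply/seteqP; split=> // xi hxi.
  have [lf _] := confP xi.
  have /finite_seqP[s sE] := lf _ (ebounded_eball0 M).
  have [N hN] : exists N, forall x, x \in s -> forall n, (N <= n)%N -> ~ F n x.
    elim: s {sE} => [|x s [N hN]]; first by exists 0%N.
    have [k nFk] : exists k, ~ F k x.
      apply: contrapT => h; have : set0 x.
        by rewrite -F0 => n _; apply: contrapT => nF; apply: h; exists n.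
      by [].
    exists (maxn N k) => y; rewrite inE => /predU1P[->|ys] n;
      rewrite geq_max => /andP[Nn kn].
      by move=> Fnx; apply: nFk; have /subsetPset := ndF _ _ kn; exact.
    exact: hN.
  have [x [xix [Fx xM]]] := hxi N I.
  by apply: (hN x _ N (leqnn N) Fx); have : [set` s] x by rewrite -sE.
have cvgS : P \o S @ \oo --> P (\bigcap_n S n).
  apply: nonincreasing_cvg_mu => //.
  - by rewrite (le_lt_trans (probability_le1 P (mS 0%N)))// ltry.
  - by rewrite S0.
  - move=> m n mn; apply/subsetPset; apply: hittingS => x [Fx xM]; split=> //.
    by have /subsetPset := ndF _ _ mn; exact.
rewrite S0 measure0 in cvgS.
have [] := (fine_cvgP _ _).1 cvgS.
move=> _ /cvgrPdist_le/(_ _ e0)[N _ /(_ N (leqnn N))/=].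
rewrite sub0r normrN ger0_norm ?fine_ge0// => h; exists N.
by rewrite -lee_fin fineK ?fin_num_measure in h.
Qed.

Lemma closed_inner A n :
  closed [set x : V | forall y, (edist x y < n.+1%:R^-1)%R -> A y].
Proof.
rewrite -openC; apply/open_edistP => x /= /existsNP[y /not_implyP[xy nAy]].
exists (n.+1%:R^-1 - edist x y)%R; rewrite ?subr_gt0// => z /= xz h; apply: nAy.
apply: h; apply: le_lt_trans (edist_triangle x z y) _.
by rewrite (edistC z x) -ltrBrDr.
Qed.

Lemma hitting_regular A (e : R) : (0 < e)%R -> borel A ->
  exists D G, [/\ closed D, open G, D `<=` A, A `<=` G &
    P (hitting ((G `\` D) `&` eball0 M)) <= e%:E].
Proof.
move=> e0 bA; move: e e0.
(* The approximable sets form a sigma-algebra containing the open sets. The precision is quantified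
   inside, since a union uses ever smaller precisions for its members. *)
pose approx A := forall e : R, (0 < e)%R -> exists D G,
  [/\ closed D, open G, D `<=` A, A `<=` G & hit_prob (G `\` D) <= e%:E].
suff : @borel R d `<=` approx by move=> /(_ _ bA); exact.
apply: smallest_sub; last first.
  move=> G oG e e0.
  pose D n := [set x : V | forall y, (edist x y < n.+1%:R^-1)%R -> G y].
  have [|||n hn] := @hit_vanish (fun n => G `\` D n) e e0.
  - move=> n; apply: borelD; first exact: borel_open.
    by apply: borel_closed; exact: closed_inner.
  - move=> m n mn; apply/subsetPset => x [Gx nDx]; split=> // Dx; apply: nDx => y xy.
    by apply: Dx; apply: lt_le_trans xy _; rewrite lef_pV2 ?posrE// ler_nat.
  - apply/seteqP; split=> // x hx; have [Gx _] := hx 0%N I.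
    have [e' e'0 he'] := (open_edistP G).1 oG x Gx.
    have [_] := hx (Num.truncn e'^-1) I; apply => y xy; apply: he' => /=.
    apply: lt_trans xy _.
    by rewrite -[ltRHS]invrK ltf_pV2 ?posrE ?invr_gt0// truncnS_gt.
  - exists (D n), G; split=> //; first exact: closed_inner.
    by move=> x; apply; rewrite edistxx invr_gt0.
split.
- move=> e e0; exists set0, set0; split; [exact: closed0|exact: open0|by []|by []|].
  rewrite /hit_prob set0D set0I (_ : hitting set0 = set0) ?measure0 ?lee_fin ?ltW//.
  by apply/seteqP; split=> // xi [x []].
- move=> A' hA e e0; have [D [G [cD oG DA AG h]]] := hA e e0.
  exists (~` G), (~` D); rewrite setTD; split.
  + by rewrite closedC.
  + by rewrite openC.
  + exact: subsetC.
  + exact: subsetC.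
  + by rewrite [_ `\` _](_ : _ = G `\` D)// !setDE setCK setIC.
- move=> F hF e e0.
  (* Half of [e] is spread geometrically over the members of the union; the other half pays for
     truncating the union of the closed sets, which need not be closed. *)
  have e20 : (0 < e / 2)%R by rewrite divr_gt0.
  have /choice[f fP] i : exists DG : set V * set V, [/\ closed DG.1, open DG.2,
      DG.1 `<=` F i, F i `<=` DG.2 &
      hit_prob (DG.2 `\` DG.1) <= (e / 2 / (2 ^ i.+1)%:R)%:E].
    have [|D [G h]] := hF i (e / 2 / (2 ^ i.+1)%:R)%R; last by exists (D, G).
    by rewrite divr_gt0// ltr0n expn_gt0.
  pose D n := \big[setU/set0]_(i < n) (f i).1.
  have DE n : D n = \bigcup_(i in `I_n) (f i).1 by rewrite bigcup_mkord.
  have cD n : closed (D n).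
    by apply: (big_ind closed) => [||i _];
      [exact: closed0|exact: closedU|have [] := fP i].
  pose DD := \bigcup_i (f i).1; pose GG := \bigcup_i (f i).2.
  have bf1 i : borel (f i).1 by apply: borel_closed; have [] := fP i.
  have bf2 i : borel (f i).2 by apply: borel_open; have [] := fP i.
  have bDD : borel DD by exact: borel_bigcup.
  have DDD n : D n `<=` DD by rewrite DE => x [i _ ?]; exists i.
  have [|||n hn] := @hit_vanish (fun n => DD `\` D n) _ e20.
  + by move=> n; apply: borelD => //; exact: borel_closed.
  + move=> m n mn; apply/subsetPset => x [DDx nDx]; split=> // Dx; apply: nDx.
    move: Dx; rewrite !DE => -[i /= im Dx]; exists i => //=.
    exact: leq_trans mn.
  + apply/seteqP; split=> // x hx; have [[i _ Dx] _] := hx 0%N I.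
    have [_] := hx i.+1 I; apply.
    by rewrite DE; exists i => //=.
  exists (D n), GG; split=> //.
  + by apply: bigcup_open => i _; have [] := fP i.
  + apply: subset_trans (DDD n) _ => x [i _ Dx]; exists i => //.
    by have [_ _ + _ _] := fP i; apply.
  + by move=> x [i _ Fx]; exists i => //; have [_ _ _ + _] := fP i; apply.
  have bGD : borel (\bigcup_i ((f i).2 `\` (f i).1)).
    by apply: borel_bigcup => i; exact: borelD.
  have bDn : borel (DD `\` D n) by apply: borelD => //; exact: borel_closed.
  apply: (@le_trans _ _ (hit_prob (\bigcup_i ((f i).2 `\` (f i).1) `|` (DD `\` D n)))).
    apply: le_hit; [|exact: borelU|].
      by apply: borelD; [exact: borel_bigcup|exact: borel_closed].
    move=> x [[i _ Gx] nDx]; have [Dx|nDDx] := pselect (DD x); first by right.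
    by left; exists i => //; split=> // Dx; apply: nDDx; exists i.
  apply: (le_trans (hitU bGD bDn)).
  rewrite (_ : e = e / 2 + e / 2)%R; last by rewrite -splitr.
  rewrite EFinD leeD//.
  apply: le_trans (hit_bigcup _) _; first by move=> i; exact: borelD.
  apply: (@le_trans _ _ (\sum_(i <oo) (e / 2 / (2 ^ i.+1)%:R)%:E)).
    by apply: lee_nneseries => // i _; have [] := fP i.
  by apply: epsilon_trick0; exact: ltW.
Qed.

End HittingRegularity.

(** * Fell-continuous test functions *)

Section FellFunctions.
Context {R : realType} {d : nat}.
Local Notation V := 'rV[R]_d.
Implicit Types (A B D G : set V).

Lemma open_fell_subbase B (U : set (conf B)) : fell_subbase U -> open U.
Proof.
move=> sU; exists [set U]; last by rewrite bigcup_set1.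
by move=> _ ->; exact: (finI_from1 id sU).
Qed.

Lemma open_hitting B G : open G -> open (hitting G : set (conf B)).
Proof. by move=> oG; apply: open_fell_subbase; left; exists G. Qed.

Lemma open_missing B D : compact D -> D `<=` B -> open (missing D : set (conf B)).
Proof. by move=> cD DB; apply: open_fell_subbase; right; exists D. Qed.

Lemma continuous_rays (T : topologicalType) (f : T -> R) :
  (forall a, open [set x | a < f x]) -> (forall a, open [set x | f x < a]) ->
  continuous f.
Proof.
move=> h1 h2 x; apply/cvgrPdist_lt => e e0.
have n1 : nbhs x [set y | f x - e < f y].
  by apply: open_nbhs_nbhs; split=> //=; rewrite gtrBl.
have n2 : nbhs x [set y | f y < f x + e].
  by apply: open_nbhs_nbhs; split=> //=; rewrite ltrDl.
near=> y.
have l1 : f x - e < f y by near: y.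
have l2 : f y < f x + e by near: y.
by rewrite ltr_norml; lra.
Unshelve. all: by end_near. Qed.

Section SupFunction.
Variables (g : V -> R) (M : R).
Hypotheses (cg : continuous g) (g0 : forall x, 0 <= g x) (g1 : forall x, g x <= 1)
  (gM : forall x, 0 < g x -> enorm x < M).

(* A Fell-continuous surrogate for the indicator of a hitting event: superlevel
   sets of [g] are open, and compact when closed at a positive level. *)
Definition conf_sup (xi : conf [set: V]) : R := sup (0 |` (g @` pts xi)).

Let has_sup_conf (xi : conf [set: V]) : has_sup (0 |` (g @` pts xi)).
Proof.
split; first by exists 0; left.
by exists 1 => _ [->|[x _ <-]].
Qed.

Lemma conf_sup_ge0 xi : 0 <= conf_sup xi.
Proof. by apply: (sup_upper_bound (has_sup_conf xi)); left. Qed.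

Lemma conf_sup_le1 xi : conf_sup xi <= 1.
Proof.
by apply: ge_sup; [exists 0; left|move=> _ [->|[x _ <-]]].
Qed.

Lemma conf_sup_ge (xi : conf [set: V]) x : pts xi x -> g x <= conf_sup xi.
Proof. by move=> xix; apply: (sup_upper_bound (has_sup_conf xi)); right; exists x. Qed.

Lemma conf_sup_gt a : 0 <= a -> [set xi | a < conf_sup xi] = hitting [set x | a < g x].
Proof.
move=> a0; apply/seteqP; split=> xi /=.
  move=> /(sup_gt (has_sup_conf xi).1)[_ [->|[x xix <-]] ax].
    by rewrite ltNge a0 in ax.
  by exists x.
by move=> [x [xix ax]]; apply: lt_le_trans ax _; exact: conf_sup_ge.
Qed.

(** An intermediate level [s] turns a strict bound on the supremum into a missing event, and [s > 0]
    makes the missed set bounded, hence compact. *)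
Lemma conf_sup_lt a : [set xi | conf_sup xi < a] =
  \bigcup_(s in [set s | 0 < s < a]) missing [set x | s <= g x].
Proof.
apply/seteqP; split=> xi /=.
  move=> Fa; have F0 := conf_sup_ge0 xi.
  exists ((conf_sup xi + a) / 2); first by rewrite /=; lra.
  apply/seteqP; split=> // x [xix /= le]; have := conf_sup_ge xix; lra.
move=> [s /= /andP[s0 sa] miss]; apply: le_lt_trans sa.
apply: ge_sup; first by exists 0; left.
move=> _ [->|[x xix <-]]; first exact: ltW.
rewrite leNgt; apply/negP => sg; have : set0 x by rewrite -miss; split=> //=; exact: ltW.
by [].
Qed.

Lemma continuous_conf_sup : continuous conf_sup.
Proof.
apply: continuous_rays => a.
  have [a0|a0] := leP 0 a.
    rewrite conf_sup_gt//; apply: open_hitting.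
    by apply: (@open_comp _ _ g [set y | a < y]) => [x _|]; [exact: cg|exact: open_gt].
  rewrite (_ : [set x | _] = setT); first exact: openT.
  by apply/seteqP; split=> // xi _ /=; apply: lt_le_trans a0 (conf_sup_ge0 xi).
rewrite conf_sup_lt; apply: bigcup_open => s /= /andP[s0 _].
apply: open_missing => //; apply: ebounded_closed_compact.
  by exists M => x /= sg; apply/ltW/gM; exact: lt_le_trans sg.
by apply: (@closed_comp _ _ g [set y | s <= y]) => [x _|]; [exact: cg|exact: closed_ge].
Qed.

Lemma measurable_conf_sup : measurable_fun setT conf_sup.
Proof.
apply: (measurability _ (RGenOInfty.measurableE R)) => _ [_ [a ->] <-]; rewrite setTI.
rewrite (_ : _ @^-1` _ = [set xi | a < conf_sup xi]); last first.
  by apply/seteqP; split=> xi; rewrite /preimage/= in_itv/= andbT.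
have [a0|a0] := leP 0 a.
  rewrite conf_sup_gt//; apply: measurable_hitting; first exact: borelT.
  apply: borel_open.
  by apply: (@open_comp _ _ g [set y | a < y]) => [x _|]; [exact: cg|exact: open_gt].
rewrite (_ : [set x | _] = setT); first exact: measurableT.
by apply/seteqP; split=> // xi _ /=; apply: lt_le_trans a0 (conf_sup_ge0 xi).
Qed.

End SupFunction.

(** Take [conf_sup] of a Urysohn function that is 1 on [D] and 0 off [G]. *)
Lemma fell_sandwich D G M : closed D -> open G -> D `<=` G -> G `<=` eball0 M ->
  exists f : conf [set: V] -> R, [/\ continuous f, measurable_fun setT f,
    forall xi, 0 <= f xi <= 1,
    forall xi, hitting D xi -> f xi = 1 & forall xi, 0 < f xi -> hitting G xi].
Proof.
move=> cD oG DG GM.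
have nV := @pseudometric_normal R V.
have sep : uniform_separator (~` G) D.
  apply: (proj1 (@normal_separatorP R V) nV) => //; first by rewrite closedC.
  by apply/seteqP; split=> // x [nGx /DG].
have [g [cg g01 gG gD]] := (uniform_separatorP (R := R) _ _).1 sep.
have g0 x : 0 <= g x.
  by have := g01 (g x) (ex_intro2 _ _ x I erefl); rewrite /= in_itv/= => /andP[].
have g1 x : g x <= 1.
  by have := g01 (g x) (ex_intro2 _ _ x I erefl); rewrite /= in_itv/= => /andP[].
have gpos x : 0 < g x -> G x.
  move=> gx; apply: contrapT => nGx.
  have : g x = 0 by apply: gG; exists x.
  by move=> gx0; rewrite gx0 ltxx in gx.
have gM x : 0 < g x -> enorm x < M by move=> /gpos/GM.
exists (conf_sup g); split.
- exact: continuous_conf_sup gM.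
- exact: measurable_conf_sup.
- by move=> xi; rewrite conf_sup_ge0// conf_sup_le1.
- move=> xi [x [xix Dx]]; apply/eqP; rewrite eq_le conf_sup_le1//=.
  have <- : g x = 1 by apply: gD; exists x.
  exact: conf_sup_ge.
- move=> xi; have := @conf_sup_gt g g1 0 (lexx 0).
  move=> /seteqP[+ _] => /(_ xi)/[apply].
  by apply: hittingS => x; exact: gpos.
Qed.

End FellFunctions.

(** * From weak convergence to convergence on local events *)

Section LocalLimit.
Context {R : realType} {d : nat}.
Local Notation V := 'rV[R]_d.
Local Notation confs := (conf [set: V]).
Implicit Types (A B D G : set V).

Lemma integral_sandwich dT (T : measurableType dT) (P : probability T R)
    (f : T -> R) (S1 S2 : set T) : measurable_fun setT f ->
  measurable S1 -> measurable S2 -> (forall t, 0 <= f t <= 1) ->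
  (forall t, S1 t -> f t = 1) -> (forall t, 0 < f t -> S2 t) ->
  (\int[P]_t (f t)%:E)%E \is a fin_num /\
  pr P S1 <= fine (\int[P]_t (f t)%:E)%E <= pr P S2.
Proof.
move=> mf mS1 mS2 f01 h1 h2.
have f0 t : 0 <= f t by case/andP: (f01 t).
have f1 t : f t <= 1 by case/andP: (f01 t).
have mfE : measurable_fun setT (EFin \o f) by exact: measurableT_comp.
have mind S : measurable S -> measurable_fun setT (EFin \o (\1_S : T -> R)).
  by move=> mS; apply/measurable_EFinP; exact: measurable_indic.
have l1 : ((pr P S1)%:E <= \int[P]_t (f t)%:E)%E.
  rewrite -prE// -[X in P X]setIT -integral_indic//; apply: ge0_le_integral => //.
  - exact: (mind _ mS1).
  - move=> t _; rewrite lee_fin indicE; case: (boolP (t \in S1)) => //= /set_mem/h1 -> //.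
have l2 : (\int[P]_t (f t)%:E <= (pr P S2)%:E)%E.
  rewrite -prE// -[X in P X]setIT -integral_indic//; apply: ge0_le_integral => //.
  - by move=> t _; rewrite lee_fin.
  - exact: (mind _ mS2).
  - move=> t _; rewrite lee_fin indicE; case: (boolP (t \in S2)) => //= /negP nS2.
    rewrite leNgt; apply/negP => /h2 S2t; apply: nS2; exact/mem_set.
have fI : (\int[P]_t (f t)%:E)%E \is a fin_num.
  rewrite ge0_fin_numE; last by apply: integral_ge0 => t _; rewrite lee_fin.
  by apply: le_lt_trans l2 _; rewrite ltry.
by split=> //; apply/andP; split; rewrite -lee_fin (fineK fI).
Qed.

Variables (P : nat -> probability confs R) (nu : probability confs R).
Hypothesis local_cauchy : forall A, bborel A -> forall e : R, 0 < e ->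
  exists N, forall n m, (N <= n)%N -> (N <= m)%N ->
  forall E : set (conf A), measurable E ->
  `|pr (P n) (restr A @^-1` E) - pr (P m) (restr A @^-1` E)| <= e.
Hypothesis weak : forall f : confs -> R, continuous f -> measurable_fun setT f ->
  (forall xi, 0 <= f xi <= 1) ->
  (\int[P n]_xi (f xi)%:E)%E @[n --> \oo] --> (\int[nu]_xi (f xi)%:E)%E.

Lemma restr_hitting A X : X `<=` A ->
  restr A @^-1` (hitting X) = hitting X :> set confs.
Proof.
move=> XA; apply/seteqP; split=> xi /= [x [xix Xx]]; exists x; split=> //.
- by case: xix.
- by split=> //; exact: XA.
Qed.

(* Fix [N] from the Cauchy property and sandwich [A] between a closed [D] and an
   open [G] whose gap is rarely hit under both [nu] and [P N]; the Cauchy property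
   carries this smallness to all [P n] with [n >= N]. *)
Lemma hitting_cvg A : bborel A ->
  pr (P n) (hitting A) @[n --> \oo] --> pr nu (hitting A).
Proof.
move=> [bA bdA]; apply/cvgrPdist_le => e e0.
have [M M0 AM] := ebounded_eball0P bdA.
(* One quarter for the gap under [nu], two for the gap under [P n] (gap under [P N] plus Cauchy
   error), one for the integrals of the test function. *)
have e40 : 0 < e / 4 by rewrite divr_gt0.
have [N hN] := local_cauchy (bborel_eball0 M) e40.
have [D1 [G1 [cD1 oG1 DA1 AG1 h1]]] := hitting_regular nu M e40 bA.
have [D2 [G2 [cD2 oG2 DA2 AG2 h2]]] := hitting_regular (P N) M e40 bA.
pose D := D1 `|` D2; pose G := G1 `&` G2 `&` eball0 M.
have cD : closed D by exact: closedU.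
have oG : open G by apply: openI; [exact: openI|exact: open_eball0].
have DA : D `<=` A by rewrite subUset.
have AG : A `<=` G by move=> x Ax; split; [split; [exact: AG1|exact: AG2]|exact: AM].
have DG : D `<=` G by exact: subset_trans AG.
have GM : G `<=` eball0 M by exact: subIsetr.
have bD := borel_closed cD; have bG := borel_open oG.
have bX : borel (G `\` D) by exact: borelD.
have XM : G `\` D `<=` eball0 M by move=> x [/GM].
have mhit X : borel X -> measurable (hitting X : set confs).
  by move=> bX'; exact: measurable_hitting (@borelT R d) bX'.
have small (Q : probability confs R) D' G' : closed D' -> open G' ->
    D' `<=` D -> G `<=` G' -> (Q (hitting ((G' `\` D') `&` eball0 M)) <= (e / 4)%:E)%E ->
    pr Q (hitting (G `\` D)) <= e / 4.
  move=> cD' oG' D'D GG' h; rewrite -lee_fin -prE; last exact: mhit.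
  apply: le_trans h; apply: le_measure; rewrite ?inE; [exact: mhit| |].
    by apply: mhit; apply: borelI; [apply: borelD; [exact: borel_open|exact: borel_closed]|
      exact: borel_eball0].
  apply: hittingS => x [Gx nDx]; split; last exact: GM.
  by split; [exact: GG'|move=> /D'D].
have nuX : pr nu (hitting (G `\` D)) <= e / 4.
  by apply: small h1 => //; [exact: subsetUl|move=> x [[]]].
have PNX : pr (P N) (hitting (G `\` D)) <= e / 4.
  by apply: small h2 => //; [exact: subsetUr|move=> x [[]]].
have PnX n : (N <= n)%N -> pr (P n) (hitting (G `\` D)) <= e / 4 + e / 4.
  move=> Nn; have := hN n N Nn (leqnn N) (hitting (G `\` D)).
  rewrite restr_hitting// => /(_ _)/le_trans h.
  have : `|pr (P n) (hitting (G `\` D)) - pr (P N) (hitting (G `\` D))| <= e / 4.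
    apply: h => //; apply: measurable_hitting => //; exact: borel_eball0.
  by rewrite ler_norml => /andP[_]; lra.
have [f [cf mf f01 fD fG]] := fell_sandwich cD oG DG GM.
have bound (Q : probability confs R) :
    `|fine (\int[Q]_t (f t)%:E)%E - pr Q (hitting A)| <= pr Q (hitting (G `\` D)).
  have [_ /andP[l1 l2]] := integral_sandwich Q mf (mhit _ bD) (mhit _ bG) f01 fD fG.
  have l3 : pr Q (hitting D) <= pr Q (hitting A).
    by apply: le_pr; [exact: mhit|exact: mhit|exact: hittingS].
  have l4 : pr Q (hitting A) <= pr Q (hitting G).
    by apply: le_pr; [exact: mhit|exact: mhit|exact: hittingS].
  have l5 : pr Q (hitting G) <= pr Q (hitting D) + pr Q (hitting (G `\` D)).
    rewrite -lee_fin EFinD -!prE; [|exact: mhit..].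
    apply: le_trans (measureU2 _ (mhit _ bD) (mhit _ bX)).
    apply: le_measure; rewrite ?inE; [exact: mhit|by apply: measurableU; exact: mhit|].
    move=> xi [x [xix Gx]]; have [Dx|nDx] := pselect (D x).
      by left; exists x.
    by right; exists x.
  by rewrite ler_norml; lra.
have finI (Q : probability confs R) : (\int[Q]_t (f t)%:E)%E \is a fin_num.
  by have [] := integral_sandwich Q mf (mhit _ bD) (mhit _ bG) f01 fD fG.
have := weak cf mf f01; rewrite -(fineK (finI nu)) => /fine_cvgP[_].
move=> /cvgrPdist_le/(_ _ e40) h.
near=> n.
have Nn : (N <= n)%N by near: n; exists N.
have hn : `|fine (\int[nu]_t (f t)%:E)%E - fine (\int[P n]_t (f t)%:E)%E| <= e / 4.
  by near: n.
have b1 := bound nu; have b2 := bound (P n); have b3 := PnX n Nn.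
move: hn b1 b2; rewrite !ler_norml; lra.
Unshelve. all: by end_near. Qed.

Lemma pr_vanish dT (T : measurableType dT) (Q : probability T R)
    (F : nat -> set T) (e : R) : 0 < e -> (forall i, measurable (F i)) ->
  nonincreasing_seq F -> \bigcap_i F i = set0 ->
  exists N, forall n, (N <= n)%N -> pr Q (F n) <= e.
Proof.
move=> e0 mF ndF F0.
have cvgF : Q \o F @ \oo --> Q (\bigcap_n F n).
  apply: nonincreasing_cvg_mu => //; last by rewrite F0.
  by rewrite (le_lt_trans (probability_le1 Q (mF 0%N)))// ltry.
rewrite F0 measure0 in cvgF; have [] := (fine_cvgP _ _).1 cvgF.
move=> _ /cvgrPdist_le/(_ _ e0)[N _ hN]; exists N => n /hN /=.
by rewrite sub0r normrN; apply: le_trans; exact: ler_norm.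
Qed.

(** Dynkin induction from the missing events. Only countable unions are delicate, since pointwise
    limits of probabilities need not be countably additive in general. *)
Lemma local_cvg A (E : set (conf A)) : bborel A -> measurable E ->
  pr (P n) (restr A @^-1` E) @[n --> \oo] --> pr nu (restr A @^-1` E).
Proof.
move=> bA; have [bA1 _] := bA; rewrite measurable_bmissing.
have mr (S : set (conf A)) : measurable S ->
    measurable (restr A @^-1` S : set confs).
  exact: measurable_restr_preimage bA1 (@borelT R d).
move: E; apply: (dynkin_induction (@measurable_bmissing R d A)
  (@setI_closed_bmissing R d A)).
- by rewrite preimage_setT prT; under eq_fun do rewrite prT; exact: cvg_cst.
- move=> _ [X [[bX bdX] XA] <-].
  have mX : measurable (hitting X : set confs).
    exact: measurable_hitting (@borelT R d) bX.
  have -> : restr A @^-1` missing X = ~` hitting X :> set confs.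
    rewrite -[in RHS](restr_hitting XA).
    by rewrite (missing_hitting A X).
  rewrite prC//; under eq_fun do rewrite prC//.
  by apply: cvgB; [exact: cvg_cst|exact: hitting_cvg].
- move=> S mS cS; rewrite preimage_setC prC; last exact: mr.
  under eq_fun do rewrite (prC _ (mr _ mS)).
  by apply: cvgB => //; exact: cvg_cst.
- move=> F mF tF cF.
  pose S n := \big[setU/set0]_(i < n) F i.
  pose U := \bigcup_k F k.
  have SE n : S n = \bigcup_(i in `I_n) F i by rewrite bigcup_mkord.
  have mS n : measurable (S n) by apply: bigsetU_measurable.
  have mU : measurable U by exact: bigcup_measurable.
  have SU n : S n `<=` U by rewrite SE => x [i _ Fx]; exists i.
  have cS n : pr (P m) (restr A @^-1` S n) @[m --> \oo] -->
      pr nu (restr A @^-1` S n).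
    elim: n => [|n IH].
      rewrite /S big_ord0 preimage_set0.
      rewrite (_ : (fun m => _) = fun=> pr nu set0); first exact: cvg_cst.
      by apply/funext => m; rewrite /pr !measure0.
    have dis : S n `&` F n = set0.
      apply/seteqP; split=> // x [Sx Fx]; move: Sx; rewrite SE => -[i /= ni Fix].
      have /trivIsetP/(_ i n I I) := tF; rewrite ltn_eqF// => /(_ erefl) Fin0.
      by have : (F i `&` F n) x by []; rewrite Fin0.
    have disr : restr A @^-1` S n `&` restr A @^-1` F n = set0 :> set confs.
      by rewrite -preimage_setI dis preimage_set0.
    rewrite /S big_ord_recr/= -/(S n) preimage_setU prU//; [|exact: mr..].
    under eq_fun do rewrite (prU _ (mr _ (mS n)) (mr _ (mF n)) disr).
    by apply: cvgD.
  have mD n : measurable (U `\` S n) by exact: measurableD.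
  have split_pr (Q : probability confs R) n : pr Q (restr A @^-1` U) =
      pr Q (restr A @^-1` S n) + pr Q (restr A @^-1` (U `\` S n)).
    rewrite -prU; [|exact: mr|exact: mr|].
      by rewrite -preimage_setU setUC setDKU.
    by apply/seteqP; split=> // xi [? []].
  have niD : nonincreasing_seq (fun n => restr A @^-1` (U `\` S n) : set confs).
    move=> m n mn; apply/subsetPset => xi [Ux nSx]; split=> // Sx; apply: nSx.
    by move: Sx; rewrite !SE => -[i /= im Fx]; exists i => //=; exact: leq_trans mn.
  have D0 : \bigcap_n (restr A @^-1` (U `\` S n) : set confs) = set0.
    apply/seteqP; split=> // xi h; have [[i _ Fi] _] := h 0%N I.
    by have [_] := h i.+1 I; apply; rewrite SE; exists i => //=.
  apply/cvgrPdist_le => e e0; have e40 : 0 < e / 4 by rewrite divr_gt0.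
  have [N hN] := local_cauchy bA e40.
  (* The tail of the union is made small under [nu] and under [P N]; the Cauchy property then bounds
     it under [P n] for every large [n]. *)
  have mDr n := mr _ (mD n).
  have [K1 hK1] := pr_vanish nu e40 mDr niD D0.
  have [K2 hK2] := pr_vanish (P N) e40 mDr niD D0.
  pose K := maxn K1 K2.
  move/cvgrPdist_le : (cS K) => /(_ _ e40) hS.
  near=> n.
  have Nn : (N <= n)%N by near: n; exists N.
  have hn : `|pr nu (restr A @^-1` S K) - pr (P n) (restr A @^-1` S K)| <= e / 4.
    by near: n.
  have h1 := hK1 K (leq_maxl _ _); have h2 := hK2 K (leq_maxr _ _).
  have h3 := hN n N Nn (leqnn N) _ (mD K).
  rewrite !(split_pr _ K).
  have p1 := pr_ge0 nu (restr A @^-1` (U `\` S K)).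
  have p2 := pr_ge0 (P n) (restr A @^-1` (U `\` S K)).
  move: hn h3; rewrite !ler_norml; lra.
Unshelve. all: by end_near. Qed.

End LocalLimit.

(** * Exponential decay *)

Section DistanceDecay.
Local Open Scope ereal_scope.
Context {R : realType} {d : nat}.
Local Notation V := 'rV[R]_d.
Implicit Types (A B C D L W : set V).

Lemma setdist_ge0 A D : 0 <= setdist A D.
Proof.
apply: le_ereal_inf_tmp => _ [x _ [y _ <-]].
by rewrite lee_fin edist_ge0.
Qed.

Lemma le_setdist A A' D D' : A `<=` A' -> D `<=` D' -> setdist A' D' <= setdist A D.
Proof.
move=> AA' DD'; apply: ereal_inf_le_tmp => _ [x Ax [y Dy <-]].
by exists x; [exact: AA'|exists y; [exact: DD'|]].
Qed.

Lemma setdist_eq0 A D : A `&` D !=set0 -> setdist A D = 0.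
Proof.
move=> [x [Ax Dx]]; apply/eqP; rewrite eq_le setdist_ge0 andbT.
by apply: ereal_inf_lbound; exists x => //; exists x => //; rewrite edistxx.
Qed.

Lemma le_diam A A' : A `<=` A' -> diam A <= diam A'.
Proof.
move=> AA'; apply: ereal_sup_le => _ [x Ax [y Ay <-]].
by exists x; [exact: AA'|exists y; [exact: AA'|]].
Qed.

Lemma diam_eball (x : V) : diam [set y | (edist x y < 2^-1)%R] <= 1.
Proof.
apply: ge_ereal_sup => _ [y /= xy [z /= xz <-]]; rewrite lee_fin.
have := edist_triangle x y z; rewrite (edistC y x); lra.
Qed.

Lemma bborel_eball (x : V) (e : R) : bborel [set y | (edist x y < e)%R].
Proof.
split; first by apply: borel_open; exact: open_eball.
exists (enorm x + e)%R => y /= xy; have := enorm_le_edist x y; lra.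
Qed.

Variables (r alpha : R) (Ppoi : probability (conf [set: V]) R) (K kappa : R).
Hypotheses (K1 : (1 <= K)%R) (kappa0 : (0 < kappa)%R).
Hypothesis hdecay : forall A B : set V, bborel A -> bborel B ->
  diam A <= 1 ->
  (Ppoi^*)%mu [set xi | set_connected r (pts xi) A B]
    <= K%:E * expeR (- (kappa%:E * setdist A B)).

Definition decay A D := K%:E * expeR (- (kappa%:E * setdist A D)).

Lemma le_decay A D (s : \bar R) : s <= setdist A D ->
  decay A D <= K%:E * expeR (- (kappa%:E * s)).
Proof.
move=> sAD; apply: lee_wpmul2l; first by rewrite lee_fin (le_trans ler01).
by rewrite lee_expeR leeN2 lee_pmul2l ?lte_fin.
Qed.

(** Holds even at distance [+oo], when one set is empty: the value is always between 0 and [K]. This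
    permits the passage to real inequalities. *)
Lemma decay_fin_num A D : decay A D \is a fin_num.
Proof.
rewrite ge0_fin_numE; last by rewrite mule_ge0 ?expeR_ge0// lee_fin (le_trans ler01).
apply: le_lt_trans (le_decay (setdist_ge0 A D)) _.
by rewrite mule0 oppe0 expeR0 mule1 ltry.
Qed.

Lemma connect_boundU A1 A2 D : connect_bound r Ppoi (A1 `|` A2) D <=
  connect_bound r Ppoi A1 D + connect_bound r Ppoi A2 D.
Proof.
rewrite /connect_bound; apply: le_trans (outer_measureU2 _ _ _).
apply: le_outer_measure => xi [x [y [[Ax|Ax] Dy xy]]]; [left|right];
  by exists x, y.
Qed.

Lemma connect_bound_cover A D (s : seq V) (c : R) :
  (forall x, connect_bound r Ppoi (A `&` [set y | (edist x y < 2^-1)%R]) D <= c%:E) ->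
  connect_bound r Ppoi
    (A `&` \bigcup_(x in [set` s]) [set y | (edist x y < 2^-1)%R]) D
  <= ((size s)%:R * c)%:E.
Proof.
move=> hc; elim: s => [|x s IH].
  rewrite set_nil bigcup_set0 setI0 mul0r.
  rewrite /connect_bound (_ : [set xi | _] = set0) ?outer_measure0//.
  by apply/seteqP; split=> // xi [x [y []]].
rewrite (_ : [set` x :: s] = x |` [set` s]); last first.
  by apply/seteqP; split=> j /=; rewrite inE => /predU1P.
rewrite bigcup_setU1 setIUr; apply: le_trans (connect_boundU _ _ _) _.
have -> : ((size (x :: s))%:R * c = c + (size s)%:R * c)%R.
  by rewrite /= -natr1 mulrDl mul1r addrC.
rewrite EFinD.
by apply: leeD.
Qed.

(** Balls of radius 1/2 have diameter at most 1, so [hdecay] applies to each piece of a finite cover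
    of [A]. The threshold depends on [A] and [e] only, not on [D]. *)
Lemma connect_bound_small A (e : R) : (0 < e)%R -> bborel A ->
  exists2 L, (0 < L)%R & forall D, bborel D -> L%:E <= setdist A D ->
    connect_bound r Ppoi A D <= e%:E.
Proof.
move=> e0 bA; have h20 : (0 < 2^-1 :> R)%R by rewrite invr_gt0.
have [s As] := ebounded_cover h20 bA.2.
(* The successor keeps [c], and hence [L], positive for an empty cover. *)
pose c : R := ((size s).+1%:R * K)%R.
have K0 : (0 < K)%R := lt_le_trans ltr01 K1.
have c0 : (0 < c)%R by rewrite mulr_gt0.
(* Chosen so that [expR (kappa * L) >= 1 + kappa * L = 1 + c / e], whence
   [c * expR (- (kappa * L)) <= e]. *)
pose L : R := (c / (kappa * e))%R.
have L0 : (0 < L)%R by rewrite divr_gt0// mulr_gt0.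
exists L => // D bD LD.
have -> : A = A `&` \bigcup_(x in [set` s]) [set y | (edist x y < 2^-1)%R].
  by apply/esym/setIidPl.
apply: le_trans (connect_bound_cover s (c := K * expR (- (kappa * L))) _) _.
  move=> x; set A' := _ `&` _.
  have AA' : A' `<=` A by exact: subIsetl.
  have bA' : bborel A' by apply: bborelIl => //; have [] := bborel_eball x 2^-1.
  apply: (@le_trans _ _ (decay A' D)).
    apply: hdecay => //; apply: le_trans (diam_eball x).
    by apply: le_diam; exact: subIsetr.
  rewrite EFinM; apply: (@le_decay A' D L%:E).
  by apply: le_trans LD _; exact: le_setdist.
rewrite lee_fin mulrA.
have kL : (kappa * L = c / e)%R 
  by rewrite /L invfM [X in (kappa * X)%R]mulrCA mulVKf// gt_eqF.
rewrite expRN -ler_pdivlMr ?invr_gt0 ?expR_gt0// invrK.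
apply: (@le_trans _ _ c); first by rewrite /c ler_pM2r// ler_nat.
apply: (@le_trans _ _ (e * (1 + kappa * L))%R).
  rewrite kL mulrDr mulr1 mulrCA divff ?gt_eqF// mulr1; lra.
by rewrite ler_pM2l// expR_ge1Dx.
Qed.

End DistanceDecay.

(** * Local convergence of the approximations of a Gibbs measure *)

Section GibbsLimit.
Local Open Scope ereal_scope.
Context {R : realType} {d : nat}.
Local Notation V := 'rV[R]_d.
Implicit Types (A D L W : set V).
Variables (r alpha lambda : R) (Ppoi : probability (conf [set: V]) R) (K kappa : R).
Hypotheses (hPpoi : is_poisson alpha Ppoi)
  (hfam : exists P, @disagreement_family R d r alpha lambda P)
  (K1 : (1 <= K)%R) (kappa0 : (0 < kappa)%R).
Hypothesis hdecay : forall A B : set V, bborel A -> bborel B ->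
  diam A <= 1 ->
  (Ppoi^*)%mu [set xi | set_connected r (pts xi) A B]
    <= K%:E * expeR (- (kappa%:E * setdist A B)).

(* Only points within [r] of [W] can be reached from [W] in one step, so the
   unbounded complement of [W] may be traded for a bounded part of it. *)
Definition outer_layer W (M : R) := ~` W `&` eball0 (M + r + 1).

Lemma bborel_outer_layer W M : borel W -> bborel (outer_layer W M).
Proof.
by move=> bW; rewrite /outer_layer setIC; apply: bborelIl;
  [exact: bborel_eball0|exact: borelC].
Qed.

Lemma outer_layerP W M w z : W `<=` eball0 M -> W w -> ~ W z ->
  (edist w z <= r)%R -> outer_layer W M z.
Proof.
move=> WM Ww nWz wz; split=> //; have := WM _ Ww; rewrite /eball0/=.
have := enorm_le_edist w z; lra.
Qed.

Variables (B C : nat -> set V) (P : forall n, probability (conf (B n)) R)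
  (nu : probability (conf [set: V]) R).
Hypotheses (vhB : van_hove B) (hC : forall n, configs (~` B n) (C n))
  (hP : forall n, is_hs r (C n) lambda (P n)) (hnu : weak_limit P nu).

Lemma van_hove_mono n m : (n <= m)%N -> B n `<=` B m.
Proof.
have [_ Bmono _ _] := vhB; elim: m => [|m IH]; first by rewrite leqn0 => /eqP ->.
rewrite leq_eqVlt => /predU1P[->//|]; rewrite ltnS => /IH h.
exact: subset_trans h (Bmono m).
Qed.

(** For [n <= m], conditioning in [B m] on the configuration outside [B n] compares both laws on
    [B n], and the disagreement must come from outside [B n], far from [A]. *)
Lemma hs_local_cauchy A (e : R) : bborel A -> (0 < e)%R ->
  exists N, forall n m, (N <= n)%N -> (N <= m)%N ->
  forall E : set (conf A), measurable E ->
  (`|pr (P n) (restr A @^-1` E) - pr (P m) (restr A @^-1` E)| <= e)%R.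
Proof.
move=> bA e0; have [bB _ _ Blarge] := vhB.
have [L L0 hL] := connect_bound_small K1 kappa0 hdecay e0 bA.
have [M M0 AM] := ebounded_eball0P bA.2.
have [N hN] := Blarge _ (bborel_eball0 (M + L)).
exists N => n m.
wlog nm : n m / (n <= m)%N.
  move=> h Nn Nm E mE; have [nm|/ltnW mn] := leqP n m; first exact: h.
  by rewrite distrC; exact: h.
move=> Nn Nm E mE.
have AB k : (N <= k)%N -> A `<=` B k.
  move=> Nk x /AM xM; apply: (hN _ Nk); move: xM; rewrite /eball0/=.
  by move/lt_trans; apply; rewrite ltrDl.
have mEk k := measurable_restr_preimage bA.1 (bB k).1 mE.
rewrite distrC -lee_fin -abse_EFin EFinB -!prE//.
have [M' _ BM'] := ebounded_eball0P (bB n).2.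
apply: (hs_volume_compare hPpoi hfam (bB m) (bB n).1 (van_hove_mono nm) (hC m) (hC n)
  (hP m) (hP n) bA.1 (AB _ Nn) (D := outer_layer (B n) M')) mE.
  by move=> w z; exact: outer_layerP.
apply: hL; first exact: bborel_outer_layer (bB n).1.
(* [A] lies in the ball of radius [M] and [B n] contains the one of radius [M + L], so a point
   outside [B n] is at distance at least [L] from [A]. *)
apply: le_ereal_inf_tmp => _ [x Ax [y [nBy _] <-]]; rewrite lee_fin leNgt.
apply/negP => xy; apply: nBy; apply: (hN _ Nn); rewrite /eball0/=.
by have := AM _ Ax; rewrite /eball0/=; have := enorm_le_edist x y; lra.
Qed.

Lemma gibbs_local_cvg A (E : set (conf A)) : bborel A -> measurable E ->
  (pr (P n) (restr A @^-1` E) @[n --> \oo] --> pr nu (restr A @^-1` E))%R.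
Proof.
move=> bA mE; have [bB _ _ _] := vhB.
(* The laws [P n] live on different spaces; their images [P'] share the space of [nu]. *)
have /choice[P' hP'] n := exists_image_law (P n)
  (measurable_restr (@borelT R d) (bB n).1).
have prP' A' (S : set (conf A')) n :
    pr (P' n) (restr A' @^-1` S) = pr (P n) (restr A' @^-1` S).
  have [P'E _] := hP' n; rewrite /pr P'E; congr (fine (P n _)).
  by apply/seteqP; split=> xi; rewrite /preimage/= restr_restr.
under eq_fun do rewrite -prP'.
apply: local_cvg => //.
  move=> A' bA' e e0; have [N hN] := hs_local_cauchy bA' e0; exists N => n m Nn Nm S mS.
  by rewrite !prP'; exact: hN.
move=> f cf mf f01; have := hnu cf.
have -> : (fun n => \int[P' n]_xi (f xi)%:E) =
    (fun n => \int[P n]_xi (f (restr setT xi))%:E).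
  apply/funext => n; have [_ hint] := hP' n.
  apply: (hint (fun xi => (f xi)%:E)) => [|xi]; first exact: measurableT_comp.
  by rewrite lee_fin; case/andP: (f01 xi).
apply; exists 1%R => xi; have /andP[f0 f1] := f01 xi.
by rewrite ger0_norm.
Qed.

End GibbsLimit.

Lemma norm_lim_le (R : realType) (u : nat -> R) (l e : R) :
  u n @[n --> \oo] --> l -> (\forall n \near \oo, (`|u n| <= e)%R) -> (`|l| <= e)%R.
Proof. by move=> /cvg_norm; exact: cvgr_to_le. Qed.

Local Open Scope ereal_scope.

Theorem theorem3p3 (R : realType) (d : nat) (r alpha lambda : R)
    (hd : (0 < d)%N) (hr : (0 <= r)%R)
    (halpha : (0 <= alpha)%R) (hlambda : (0 <= lambda)%R)
    (hcrit : alpha%:E < lambda_b d r)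
    (hfam : exists P, @disagreement_family R d r alpha lambda P)
    (Ppoi : probability (conf [set: 'rV[R]_d]) R)
    (hPpoi : is_poisson alpha Ppoi)
    (K kappa : R) (hK : (1 <= K)%R) (hkappa : (0 < kappa)%R)
    (hdecay : forall A B : set 'rV[R]_d, bborel A -> bborel B ->
       diam A <= 1 ->
       (Ppoi^*)%mu [set xi | set_connected r (pts xi) A B]
         <= K%:E * expeR (- (kappa%:E * setdist A B))) :
  (forall A B C : set 'rV[R]_d, bborel A -> bborel B ->
     diam A <= 1 -> A `<=` B -> configs (~` B) C ->
   forall x : 'rV[R]_d, (~` (B `|` C)) x ->
   forall P1 P2 : probability (conf B) R,
     is_hs r C lambda P1 -> is_hs r (C `|` [set x]) lambda P2 ->
   forall E : set (conf A), measurable E ->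
     `| P1 (restr A @^-1` E) - P2 (restr A @^-1` E) |
       <= K%:E * expeR (- (kappa%:E * setdist A [set x])))
  /\
  forall nu : probability (conf [set: 'rV[R]_d]) R, gibbs d r lambda nu ->
  (forall A B C : set 'rV[R]_d, bborel A -> bborel B ->
     diam A <= 1 -> A `<=` B -> configs (~` B) C ->
   forall P : probability (conf B) R, is_hs r C lambda P ->
   forall E : set (conf A), measurable E ->
     `| P (restr A @^-1` E) - nu (restr A @^-1` E) |
       <= K%:E * expeR (- (kappa%:E * setdist A (~` B))))
  /\
  (forall A B : set 'rV[R]_d, bborel A -> bborel B -> diam A <= 1 ->
   forall (E : set (conf A)) (F : set (conf B)), measurable E -> measurable F ->
     `| nu (restr A @^-1` E `&` restr B @^-1` F)
          - nu (restr A @^-1` E) * nu (restr B @^-1` F) |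
       <= K%:E * expeR (- (kappa%:E * setdist A B))).

Proof.
split.
  move=> A B C bA bB dA AB hC x xBC P1 P2 hP1 hP2 E mE.
  have bx : bborel [set x].
    split; last by exists (enorm x) => _ ->.
    rewrite (_ : [set x] = [set y | (edist x y <= 0)%R]).
      by apply: borel_closed; exact: closed_eball.
    apply/seteqP; split=> y /=; first by move=> ->; rewrite edistxx.
    by move=> xy; apply/esym/edist_eq0/eqP; rewrite eq_le xy edist_ge0.
  apply: (le_trans _ (hdecay _ _ bA bx dA)).
  have hCx : configs (~` B) (C `|` [set x]).
    apply: configsU => //; split; last by move=> _ ->; move=> Bx; apply: xBC; left.
    by move=> D _; exact: finite_setIl.
  apply: (hs_coupling hPpoi hfam bB hC hCx bA.1 AB _ hP1 hP2 mE).
  (* The boundary conditions differ at most at [x]. *)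
  by move=> w z _ [[Cz nC]|[[Cz|->] nC]] _ //; case: nC; left.
move=> nu [Bn [Cn [Pn [vhB hCn hPn hnu]]]].
have [bBn _ _ Blarge] := vhB.
have lcvg (A : set 'rV[R]_d) (E : set (conf A)) := gibbs_local_cvg hPpoi hfam hK hkappa
  hdecay vhB hCn hPn hnu (A := A) (E := E).
split.
  move=> A B C bA bB dA AB hC P hPB E mE.
  have mEB := measurable_restr_preimage bA.1 bB.1 mE.
  have mEV := measurable_restr_preimage bA.1 (@borelT R d) mE.
  have fB := decay_fin_num hK hkappa A (~` B).
  rewrite -[leRHS](fineK fB) !prE// -EFinB abse_EFin lee_fin distrC.
  pose u n := (pr (Pn n) (restr A @^-1` E) - pr P (restr A @^-1` E))%R.
  apply: (norm_lim_le (u := u)).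
    by apply: cvgB; [exact: lcvg|exact: cvg_cst].
  have [N hN] := Blarge B bB; exists N => // n Nn /=.
  have BBn := hN n Nn.
  have mEn := measurable_restr_preimage bA.1 (bBn n).1 mE.
  have [M _ BM] := ebounded_eball0P bB.2.
  rewrite /u -lee_fin -abse_EFin EFinB -!prE//.
  apply: (hs_volume_compare hPpoi hfam (bBn n) bB.1 BBn (hCn n) hC (hPn n) hPB bA.1 AB
    (D := outer_layer r B M)) mE.
    by move=> w z; exact: outer_layerP.
  rewrite fineK//.
  apply: le_trans (hdecay _ _ bA (bborel_outer_layer r M bB.1) dA) _.
  (* The layer is part of the complement of [B], hence at least as far from [A]. *)
  by apply: le_decay => //; apply: le_setdist => // z [].
move=> A B bA bB dA E F mE mF.
have mEV := measurable_restr_preimage bA.1 (@borelT R d) mE.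
have mFV := measurable_restr_preimage bB.1 (@borelT R d) mF.
have mEFV := measurableI _ _ mEV mFV.
(* If [A] meets [B], the distance is 0 and the right-hand side is [K >= 1], which bounds any
   covariance of events. *)
have [AB0|/set0P AB] := eqVneq (A `&` B) set0; last first.
  rewrite setdist_eq0// mule0 oppe0 expeR0 mule1 !prE// -EFinM -EFinB abse_EFin lee_fin.
  apply: (le_trans _ hK).
  have l1 := pr_le1 nu mEV; have l2 := pr_le1 nu mFV; have l3 := pr_le1 nu mEFV.
  have g1 := pr_ge0 nu (restr A @^-1` E); have g2 := pr_ge0 nu (restr B @^-1` F).
  have g3 := pr_ge0 nu (restr A @^-1` E `&` restr B @^-1` F).
  rewrite ler_norml; nra.
have fAB := decay_fin_num hK hkappa A B.
rewrite -[leRHS](fineK fAB) !prE// -EFinM -EFinB abse_EFin lee_fin.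
pose u n := (pr (Pn n) (restr A @^-1` E `&` restr B @^-1` F) -
  pr (Pn n) (restr A @^-1` E) * pr (Pn n) (restr B @^-1` F))%R.
apply: (norm_lim_le (u := u)).
  have bAB : bborel (A `|` B) by exact: bborelU.
  (* The joint event is local too, on [A]|[B], so [lcvg] covers it. *)
  pose EF := (restr A @^-1` E `&` restr B @^-1` F : set (conf (A `|` B))).
  have mEF : measurable EF.
    by apply: measurableI; apply: measurable_restr_preimage => //; have [] := bA;
      have [] := bB; have [] := bAB.
  have rEF L : restr (A `|` B) @^-1` EF =
      restr A @^-1` E `&` restr B @^-1` F :> set (conf L).
    by apply/seteqP; split=> xi; rewrite /EF /preimage/= !restr_restr//;
      first [exact: subsetUl|exact: subsetUr].
  apply: cvgB; last by apply: cvgM; exact: lcvg.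
  by rewrite -rEF; under eq_fun do rewrite -rEF; exact: lcvg.
have [N hN] := Blarge _ (bborelU bA bB); exists N => // n Nn /=.
have [AL BL] : A `<=` Bn n /\ B `<=` Bn n by have := hN n Nn; rewrite subUset.
have mEn := measurable_restr_preimage bA.1 (bBn n).1 mE.
have mFn := measurable_restr_preimage bB.1 (bBn n).1 mF.
rewrite /u -lee_fin -abse_EFin EFinB EFinM -!prE//; last exact: measurableI.
apply: (hs_decorrelation hPpoi hfam (bBn n) bA.1 bB.1 AL BL AB0 (hCn n) (hPn n)) => //.
by rewrite fineK//; exact: hdecay.
Qed.
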